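(* Let $B\subset\mathbb{R}$ be an interval and let $S$ and $T$ both be number theoretic fibred maps on $B$. Denote by $A_n(x)$ the cylinder of rank $n$ of $S$ containing $x$ and by $B_m(x)$ the cylinder of rank $m$ of $T$ containing $x$. For $x\in B$ and $n\ge 1$ let $m(x,n)$ be the largest integer $m\ge 0$ such that $A_n(x)\subset B_m(x)$. Suppose that $T$ is $r$-regular for some $r\in\mathbb{N}$. Then for Lebesgue-almost all $x\in B$, $$\lim_{n\to\infty}\frac{m(x,n)}{n}=\frac{h(S)}{h(T)},$$ where $h(S)$ and $h(T)$ denote the measure-theoretic entropies of $S$ and $T$ with respect to their invariant probability measures $\mu_S$ and $\mu_T$.
   Context: Throughout, $\lambda$ denotes Lebesgue measure. Fibred system. Let $B$ be an interval in $\mathbb{R}$ and $T:B\to B$ a surjective map. The pair $(B,T)$ is a fibred system if: (a) there is a finite or countably infinite set $D$ (the digit set); (b) there is a map $k:B\to D$ such that the sets $B(i)=k^{-1}\{i\}$, $i\in D$, form a partition of $B$; the sets $B(i)$ are assumed to be intervals, and $\mathcal{P}=\{B(i): i\in D\}$ is assumed to be a generating partition for $T$; (c) the restriction of $T$ to any $B(i)$ is an injective continuous map. Cylinders. The cylinder of rank $n$ determined by digits $k_1,\dots,k_n\in D$ is $B(k_1,\dots,k_n)=B(k_1)\cap T^{-1}B(k_2)\cap\dots\cap T^{-n+1}B(k_n)$; the cylinder of rank $0$ is $B$. $B_n(x)$ denotes the rank $n$ cylinder containing $x$. A sequence $(k_1,\dots,k_n)\in D^n$ is admissible if there is $x\in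 B$ with $T^{i-1}x\in B(k_i)$ for $1\le i\le n$. Two cylinders $B_n,B_n^*$ of rank $n$ are adjacent if they are contained in the same cylinder of rank $n-1$ and $\overline{B_n}\cap\overline{B_n^*}\ne\emptyset$. Number theoretic fibred map. A fibred system $(B,T)$ is a number theoretic fibred system, and $T$ a number theoretic fibred map, if in addition: (d) $T$ has an invariant probability measure $\mu_T$ for which there exist constants $0<c_1<c_2<\infty$ with $c_1\lambda(E)\le\mu_T(E)\le c_2\lambda(E)$ for every Borel set $E\subset B$; and (e) $T$ is ergodic with respect to $\mu_T$. (Each of $S$ and $T$ has its own digit set, digit map, partition and invariant measure.) $r$-regularity. Let $T$ be a number theoretic fibred map. For an interval $I\subset B$ of positive length let $m=m(I)\ge 0$ be the largest integer for which there is an admissible sequence of digits $a_1,\dots,a_m$ with $I\subset B(a_1,\dots,a_m)$. For $r\in\mathbb{N}$, $T$ is $r$-regular if for some constant $L\ge 1$: (i) for every $n$ and every pair $B_n,B_n^*$ of adjacent cylinders of rank $n$, $\frac1L\le\frac{\lambda(\overline{B_n})}{\lambda(\overline{B_n^*})}\le L$; (ii) for every such interval $I$ and almost every $x\in I$ there is a positive integer $j\le r$ such that either $B_{m+j}(x)\subset I$ or $B_{m+j}^*\subset I$ for some cylinder $B_{m+j}^*$ of rank $m+j$ adjacent to $B_{m+j}(x)$, where $m=m(I)$.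
   Formalization: Added assumptions: if h(S) is finite, the digit partition of S has finite entropy, and likewise for T (without this the claim fails, e.g. for rotations with an infinite-entropy partition); h(T) is nonzero; h(S), h(T) are not both infinite, so that the quotient is defined. *)

(* Defs.v *)
From HB Require Import structures.
From mathcomp Require Import all_boot all_order all_algebra.
From mathcomp Require Import all_classical all_reals all_analysis.
Set Implicit Arguments.
Unset Strict Implicit.
Unset Printing Implicit Defensive.
Import Order.TTheory GRing.Theory Num.Theory.
Import numFieldNormedType.Exports.
Local Open Scope classical_set_scope.
Local Open Scope ring_scope.

(* A map T : B -> B is represented by a function T : R -> R with T(B) = B;
   its values outside B are never used.  A measure on B is represented by a
   Borel measure on R giving full mass to B. *)

(* The junk value 0 is returned if P is empty or unbounded. *)
Definition largest (P : set nat) : nat :=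
  xget 0%N [set m | P m /\ forall l, P l -> (l <= m)%N].

Section Cylinders.
Variables (R : realType) (B : set R) (T : R -> R).

(* With n = 0 this is B. *)
Definition cylinder (I : Type) (A : I -> set R) (n : nat) (w : n.-tuple I) :
    set R :=
  [set x | B x /\ forall i : 'I_n, A (tnth w i) (iter i T x)].

Variables (D : countType) (k : R -> D).

Definition digit_set (i : D) : set R := B `&` k @^-1` [set i].

Definition is_cylinder (n : nat) (C : set R) : Prop :=
  exists w : n.-tuple D, C = cylinder digit_set w.

Definition cylinder_at (n : nat) (x : R) : set R :=
  cylinder digit_set [tuple k (iter i T x) | i < n].

Definition admissible (n : nat) (w : n.-tuple D) : Prop :=
  exists2 x, B x & forall i : 'I_n, digit_set (tnth w i) (iter i T x).

(* Adjacent cylinders are understood to be distinct. *)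
Definition adjacent (n : nat) (C C' : set R) : Prop :=
  [/\ is_cylinder n C, is_cylinder n C', C <> C',
      (exists C0, [/\ is_cylinder n.-1 C0, C `<=` C0 & C' `<=` C0]) &
      closure C `&` closure C' !=set0].

(* The cylinders of all ranks generate the Borel sets of B up to null sets. *)
Definition generating : Prop :=
  forall E : set (measurableTypeR R), measurable E -> E `<=` B ->
    exists2 G : set R, <<s B, [set C | exists n, is_cylinder n C] >> G &
      (@lebesgue_measure R (E `\` G `|` G `\` E) = 0)%E.

Record fibred_system : Prop := FibredSystem {
  fibred_interval : is_interval B;
  fibred_surjective : T @` B = B;
  fibred_partition : partition setT digit_set B;
  fibred_digit_interval : forall i, is_interval (digit_set i);
  fibred_generating : generating;
  fibred_injective : forall i, set_inj (digit_set i) T;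
  fibred_continuous : forall i, {within digit_set i, continuous T} }.

Record number_theoretic (mu : probability (measurableTypeR R) R) : Prop :=
  NumberTheoretic {
  nt_fibred : fibred_system;
  nt_mass : (mu B = 1)%E;
  nt_invariant : forall E : set (measurableTypeR R),
    measurable E -> E `<=` B -> mu (B `&` T @^-1` E) = mu E;
  nt_equivalent : exists c1 c2 : R, [/\ 0 < c1, c1 < c2 &
    forall E : set (measurableTypeR R), measurable E -> E `<=` B ->
      (c1%:E * lebesgue_measure E <= mu E)%E /\
      (mu E <= c2%:E * lebesgue_measure E)%E];
  nt_ergodic : forall E : set (measurableTypeR R),
    measurable E -> E `<=` B -> B `&` T @^-1` E = E ->
    (mu E = 0)%E \/ (mu E = 1)%E }.

(* The number m(I). *)
Definition interval_rank (I : set R) : nat :=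
  largest [set m | exists2 w : m.-tuple D,
                     admissible w & I `<=` cylinder digit_set w].

Definition regular (r : nat) : Prop :=
  exists2 L : R, 1 <= L &
    (forall n C C', adjacent n C C' ->
       L^-1 <= fine (lebesgue_measure (closure C)) /
               fine (lebesgue_measure (closure C')) <= L) /\
    (forall I : set R, is_interval I -> I `<=` B ->
       (0 < @lebesgue_measure R I)%E ->
       {ae @lebesgue_measure R, forall x, I x ->
          exists2 j, (0 < j <= r)%N &
            let n := (interval_rank I + j)%N in
            cylinder_at n x `<=` I \/
            exists2 C, adjacent n (cylinder_at n x) C & C `<=` I}).

End Cylinders.

Section Entropy.
Variables (R : realType) (B : set R) (T : R -> R).
Variable mu : probability (measurableTypeR R) R.
Local Open Scope ereal_scope.

(* Shannon entropy; since ln 0 = 0, null sets contribute 0. *)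
Definition partition_entropy (I : choiceType) (A : I -> set R) : \bar R :=
  \esum_(i in [set: I]) (- (fine (mu (A i)) * ln (fine (mu (A i)))))%:E.

(* The sets [cylinder B T A w], for w an n-tuple of indices, are the members of
   the join of A, T^-1 A, ..., T^-(n-1) A. *)
Definition entropy_wrt (I : choiceType) (A : I -> set R) : \bar R :=
  limn (fun n => (n%:R^-1)%:E *
    partition_entropy (fun w : n.-tuple I => cylinder B T A w)).

Definition entropy : \bar R :=
  ereal_sup [set h | exists (p : nat) (A : 'I_p -> set (measurableTypeR R)),
    [/\ forall i, measurable (A i), partition setT A B & h = entropy_wrt A]].

End Entropy.

(* The number m(x, n): the first map is (S, kS), the second is (T, kT). *)
Definition matching_rank (R : realType) (B : set R)
    (S : R -> R) (DS : countType) (kS : R -> DS)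
    (T : R -> R) (DT : countType) (kT : R -> DT) (x : R) (n : nat) : nat :=
  largest [set m | cylinder_at B S kS n x `<=` cylinder_at B T kT m x].

(* Main.v *)
(* Write A_n(x), B_m(x) for the cylinders of S and T.  With m = m(x,n) one has
   lambda(A_n) <= lambda(B_m), and regularity applied to the interval A_n(x),
   for each of the countably many cylinders, gives
   lambda(B_(m+r)) <= L lambda(A_n).  So the theorem follows from the almost
   sure convergence -ln lambda(A_n(x)) / n --> h(S) and its analogue for T,
   where h is a supremum over finite partitions.

   Both halves of this convergence are proved by coding.  Assume that the name
   of almost every point under a finite labelling psi has, for infinitely many
   n, a prefix of length n and probability at least exp(-cn).  Cutting an orbit
   into such prefixes, with single letters wherever no good prefix of bounded
   length starts, gives a code for psi-names of cost about cN for names of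
   length N; transmitting the rare disagreements of psi with another labelling
   phi turns it into a code for phi-names.  The Kraft inequality of this code
   bounds the entropy of phi-names on average (Gibbs inequality) and almost
   surely (Borel-Cantelli, with a maximal inequality for the errors).  Taking
   for phi a finite partition and for psi its approximation by cylinders, this
   shows that the cylinders cannot be too large; taking for phi the digit
   partition and for psi a finite lumping of it, that they cannot be too small.
   The exceptional sets are decided by a 0-1 law for forward invariant sets. *)
Require Import Defs.
From HB Require Import structures.
From mathcomp Require Import all_boot all_order all_algebra.
From mathcomp Require Import all_classical all_reals all_analysis.
From mathcomp Require Import measurable_realfun.
From mathcomp Require Import ring lra zify.
Set Implicit Arguments.
Unset Strict Implicit.
Unset Printing Implicit Defensive.
Import Order.TTheory GRing.Theory Num.Theory.
Import numFieldNormedType.Exports.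
Local Open Scope classical_set_scope.
Local Open Scope ring_scope.


(** * Countable labels and information *)

(** The coding turns a lower limit into an upper one: good blocks found at infinitely many lengths
    can be concatenated, and the resulting code bounds all long names. Everything passes through one
    inequality, that [expR (info - cost)] has integral at most [1]; the bound on average and the
    almost sure bound are two ways of reading it. The obstacle is that [entropy] sees finite
    partitions only, while there may be infinitely many digits. A finite labelling [psi] has its
    positive letter probabilities bounded below, so a letter sent alone has bounded cost. The
    unbounded cost of the rare letters of [phi] is paid only where [phi] and [psi] disagree, and is
    integrable because [phi] has finite entropy. The tolerated disagreement depends on [phi] and [e]
    alone, so [psi] can be chosen after it. The events at hand are not exactly invariant; a free
    additive constant in the exponent makes them forward invariant, which suffices for the 0-1
    law. *)

Section EsumLemmas.
Variable R : realType.

Lemma esumZl_le (I : choiceType) (c : R) (a : I -> \bar R) :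
  0 <= c -> (forall i, 0 <= a i)%E ->
  (\esum_(i in [set: I]) (c%:E * a i) <=
   c%:E * \esum_(i in [set: I]) a i)%E.
Proof.
move=> c0 a0; apply: ge_ereal_sup => _ [F [finF _] <-].
rewrite -ge0_mule_fsumr//; apply: lee_wpmul2l; first by rewrite lee_fin.
by apply: ereal_sup_ubound; exists F.
Qed.

Lemma esum_pair_le (I J : choiceType) (a : I * J -> \bar R) :
  (forall p, 0 <= a p)%E ->
  (\esum_(p in [set: I * J]) a p <=
   \esum_(i in [set: I]) \esum_(j in [set: J]) a (i, j))%E.
Proof.
move=> a0; rewrite (@esum_esum _ _ _ setT (fun=> setT) (fun i j => a (i, j)))//.
rewrite (_ : [set: I] `*`` (fun=> [set: J]) = setT); last exact/seteqP.
by apply: le_esum => -[].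
Qed.

Lemma esum_countable (I : countType) (a : I -> \bar R) (b : nat -> \bar R) :
  (forall i, b (pickle i) = a i) -> (forall n, (0 <= b n)%E) ->
  (forall n, (forall i : I, pickle i != n) -> b n = 0%E) ->
  (\sum_(n <oo) b n = \esum_(i in [set: I]) a i)%E.
Proof.
move=> ba b0 bn0; rewrite nneseries_esumT//.
transitivity (\esum_(n in range (@pickle I)) b n); last first.
  rewrite esum_image; last by move=> x y _ _; exact: (pcan_inj pickleK).
  by apply: eq_esum => i _; exact: ba.
rewrite [RHS]esum_mkcond; apply: eq_esum => n _; case: ifPn => // /negP nP.
by apply: bn0 => i; apply/eqP => e; apply: nP; rewrite inE; exists i.
Qed.
End EsumLemmas.

Section Labels.
Context d (X : measurableType d) (R : realType).
Variable mu : probability X R.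

(** For a countable alphabet, measurable fibres amount to measurability for the discrete
    sigma-algebra ([label_preimage]); the alphabets themselves carry no measurable structure. *)
Definition label (I : Type) (f : X -> I) :=
  forall i, measurable (f @^-1` [set i]).

Lemma label_preimage (I : countType) (f : X -> I) (Y : set I) :
  label f -> measurable (f @^-1` Y).
Proof.
move=> lf; rewrite (_ : f @^-1` Y = \bigcup_i
    (if i \in Y then f @^-1` [set i] else set0)).
  by apply: countable_bigcupT_measurable => [|i]; [exact: countableP|case: ifP].
apply/seteqP; split=> x /=; first by move=> Yf; exists (f x); rewrite ?mem_set.
by move=> [i _]; case: ifPn => //; rewrite inE => Yi /= ->.
Qed.

Lemma label_comp (I J : countType) (f : X -> I) (g : I -> J) :
  label f -> label (g \o f).
Proof. by move=> lf j; apply: (label_preimage (g @^-1` [set j])). Qed.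

Lemma label_pair (I J : countType) (f : X -> I) (g : X -> J) :
  label f -> label g -> label (fun x => (f x, g x)).
Proof.
move=> lf lg [i j]; rewrite (_ : _ @^-1` _ = f @^-1` [set i] `&` g @^-1` [set j]).
  exact: measurableI.
by apply/seteqP; split=> x /= => [[-> ->]|[-> ->]].
Qed.

Lemma label_measurable_fun (I : countType) (f : X -> I) d' (Y : measurableType d')
    (F : I -> Y) : label f -> measurable_fun setT (fun x => F (f x)).
Proof.
by move=> lf _ Z mZ; rewrite setTI; exact: (label_preimage (F @^-1` Z)).
Qed.

(** The cells are renumbered by [pickle] so that countable additivity over [nat] applies; a number
    that codes no letter gives an empty cell. *)
Lemma integral_label (I : countType) (f : X -> I) (E : set X) (F : X -> \bar R) :
  label f -> measurable E -> measurable_fun E F ->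
  (forall x, E x -> 0 <= F x)%E ->
  (\int[mu]_(x in E) F x =
   \esum_(i in [set: I]) \int[mu]_(x in E `&` f @^-1` [set i]) F x)%E.
Proof.
move=> lf mE mF F0.
pose G n := E `&` [set x | pickle (f x) = n].
have mG n : measurable (G n).
  by apply: measurableI => //; exact: (label_preimage [set i | pickle i = n]).
have EG : E = \bigcup_n G n.
  by apply/seteqP; split=> [x Ex|x [n _ []]//]; exists (pickle (f x)).
have sG n : G n `<=` E by move=> x [].
have Gi i : G (pickle i) = E `&` f @^-1` [set i].
  by congr (_ `&` _); apply/seteqP; split=> x /= => [/(pcan_inj pickleK)|->].
rewrite [in LHS]EG ge0_integral_bigcup//.
- apply: esum_countable => [i|n|n ni].
  + by rewrite Gi.
  + by apply: integral_ge0 => x /sG/F0.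
  + rewrite (_ : G n = set0) ?integral_set0//; apply/seteqP; split=> x //=.
    by move=> [_ /= e]; have := ni (f x); rewrite e eqxx.
- by rewrite -EG.
- by move=> x; rewrite -EG; exact: F0.
- apply/trivIsetP => m n _ _ mn; apply/seteqP; split=> x //= [[_ /= em] [_ /= en]].
  by move: mn; rewrite -em -en eqxx.
Qed.

Lemma measure_label (I : countType) (f : X -> I) (E : set X) :
  label f -> measurable E ->
  (mu E = \esum_(i in [set: I]) mu (E `&` f @^-1` [set i]))%E.
Proof.
move=> lf mE; rewrite -(mul1e (mu E)) -integral_cst//.
rewrite (integral_label lf)//; apply: eq_esum => i _.
by rewrite integral_cst ?mul1e//; exact: measurableI.
Qed.

Definition prob (I : Type) (f : X -> I) (x : X) : R :=
  fine (mu (f @^-1` [set f x])).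

(* Since [ln 0 = 0], the information is [0] on null cells. *)
Definition info (I : Type) (f : X -> I) (x : X) : R := - ln (prob f x).

Lemma fine_probE (E : set X) : measurable E -> (fine (mu E))%:E = mu E.
Proof. by move=> mE; rewrite fineK// fin_num_measure. Qed.

Lemma integral_cst_prob (E : set X) (c : R) : measurable E ->
  (\int[mu]_(x in E) c%:E = (c * fine (mu E))%:E)%E.
Proof. by move=> mE; rewrite integral_cst// EFinM fine_probE. Qed.

Lemma fine_prob_ge0 (E : set X) : 0 <= fine (mu E).
Proof. by rewrite fine_ge0. Qed.

Lemma fine_prob_le1 (E : set X) : measurable E -> fine (mu E) <= 1.
Proof. by move=> mE; rewrite -lee_fin fine_probE// probability_le1. Qed.

Lemma le_fine_prob (E F : set X) :
  measurable E -> measurable F -> E `<=` F -> fine (mu E) <= fine (mu F).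
Proof.
by move=> mE mF EF; rewrite -lee_fin !fine_probE// le_measure ?inE.
Qed.

Section OneLabel.
Variables (I : countType) (f : X -> I).
Hypothesis lf : label f.

Lemma prob_ge0 x : 0 <= prob f x. Proof. exact: fine_prob_ge0. Qed.

Lemma prob_le1 x : prob f x <= 1. Proof. exact: fine_prob_le1. Qed.

Lemma info_ge0 x : 0 <= info f x.
Proof. by rewrite oppr_ge0 ln_le0// prob_le1. Qed.

Lemma measurable_info : measurable_fun setT (info f).
Proof. exact: (label_measurable_fun (fun i => - ln (fine (mu (f @^-1` [set i]))))). Qed.

Lemma expR_info x : 0 < prob f x -> expR (info f x) = (prob f x)^-1.
Proof. by move=> p0; rewrite /info expRN lnK. Qed.

Lemma prob_expR x : 0 < prob f x -> prob f x = expR (- info f x).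
Proof. by move=> p0; rewrite /info opprK lnK. Qed.

(** The null cells are countably many, so their union is null. Off it [ln] avoids its default value
    and [prob_expR] applies. *)
Lemma ae_prob_gt0 : {ae mu, forall x, 0 < prob f x}.
Proof.
exists [set x | prob f x <= 0]; split.
- exact: (label_preimage [set i | fine (mu (f @^-1` [set i])) <= 0]).
- have mE : measurable [set x | prob f x <= 0].
    exact: (label_preimage [set i | fine (mu (f @^-1` [set i])) <= 0]).
  rewrite (measure_label lf mE) esum1// => i _.
  have [fi0|fi0] := leP (fine (mu (f @^-1` [set i]))) 0.
    apply: (@subset_measure0 _ _ _ mu _ (f @^-1` [set i])) => //.
    - exact: measurableI.
    - have fi : fine (mu (f @^-1` [set i])) = 0.
        by apply/le_anti; rewrite fi0 fine_prob_ge0.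
      by rewrite -[LHS](fine_probE (lf i)) fi.
  rewrite (_ : _ `&` _ = set0) ?measure0//; apply/seteqP; split=> x //= [+ fx].
  by rewrite /prob fx leNgt fi0.
- by move=> x /= /negP; rewrite -leNgt.
Qed.
End OneLabel.

Lemma prob_refine (I J : countType) (f : X -> I) (g : X -> J) x :
  label f -> label g -> (forall y, f y = f x -> g y = g x) -> prob f x <= prob g x.
Proof. by move=> lf lg fg; apply: le_fine_prob => // y /fg. Qed.

End Labels.


(** * Words and codes *)

Section Names.
Variables (X : Type) (tau : X -> X).

Fixpoint name (I : Type) (phi : X -> I) (n : nat) (x : X) : seq I :=
  if n is m.+1 then phi x :: name phi m (tau x) else [::].

Section OneMap.
Variables (I : Type) (phi : X -> I).

Lemma size_name n x : size (name phi n x) = n.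
Proof. by elim: n x => //= n IH x; rewrite IH. Qed.

Lemma take_name m n x : (m <= n)%N -> take m (name phi n x) = name phi m x.
Proof. by elim: m n x => [|m IH] [|n] x //=; rewrite ltnS => /IH ->. Qed.

Lemma drop_name m n x :
  drop m (name phi n x) = name phi (n - m) (iter m tau x).
Proof.
elim: m n x => [|m IH] n x; first by rewrite drop0 subn0.
by case: n => [|n] //=; rewrite subSS IH -iterSr.
Qed.

Lemma nth_name x0 n i x :
  (i < n)%N -> nth x0 (name phi n x) i = phi (iter i tau x).
Proof.
elim: n i x => // n IH [|i] x //=; rewrite ltnS => /IH ->.
by rewrite -iterSr.
Qed.

Lemma eq_nameP n x y :
  name phi n x = name phi n y <->
  (forall i, (i < n)%N -> phi (iter i tau x) = phi (iter i tau y)).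
Proof.
elim: n x y => [|n IH] x y /=; first by split.
split=> [[e0 /IH e] [|i] //|e]; first by rewrite ltnS => /e; rewrite !iterSr.
rewrite (e 0%N)//; congr (_ :: _); apply/IH => i lin.
by rewrite -!iterSr; exact: e.
Qed.

Lemma eq_name_le m n x y : (m <= n)%N ->
  name phi n x = name phi n y -> name phi m x = name phi m y.
Proof. by move=> mn e; rewrite -(take_name x mn) e take_name. Qed.
End OneMap.

Lemma map_name (I J : Type) (g : I -> J) (phi : X -> I) n x :
  map g (name phi n x) = name (g \o phi) n x.
Proof. by elim: n x => //= n IH x; rewrite IH. Qed.

End Names.

(** * Sums over words *)

Section WordSums.
Variable R : realType.

(** Summing letter by letter matches the recursion of [name], so that inductions peel off the first
    letter. The value is extended because the alphabet may be infinite. *)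
Fixpoint word_sum (I : choiceType) (n : nat) (F : seq I -> R) : \bar R :=
  if n is m.+1 then
    (\esum_(a in [set: I]) word_sum m (fun v => F (a :: v)))%E
  else (F [::])%:E.

Section OneAlphabet.
Variable I : choiceType.
Implicit Types F G : seq I -> R.

Lemma word_sum_ge0 n F : (forall w, 0 <= F w) -> (0 <= word_sum n F)%E.
Proof.
elim: n F => [|n IH] F F0 /=; first by rewrite lee_fin.
by apply: esum_ge0 => a _; exact: IH.
Qed.

Lemma le_word_sum n F G :
  (forall w, F w <= G w) -> (word_sum n F <= word_sum n G)%E.
Proof.
elim: n F G => [|n IH] F G FG /=; first by rewrite lee_fin.
by apply: le_esum => a _; exact: IH.
Qed.

Lemma word_sumZ_le n (c : R) F : 0 <= c -> (forall w, 0 <= F w) ->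
  (word_sum n (fun w => c * F w)%R <= c%:E * word_sum n F)%E.
Proof.
move=> c0; elim: n F => [|n IH] F F0 /=; first by rewrite EFinM.
apply: le_trans (esumZl_le c0 _); last by move=> a; exact: word_sum_ge0.
by apply: le_esum => a _; exact: IH.
Qed.

Lemma word_sumD n F G : (forall w, 0 <= F w) -> (forall w, 0 <= G w) ->
  word_sum n (fun w => F w + G w) = (word_sum n F + word_sum n G)%E.
Proof.
elim: n F G => [|n IH] F G F0 G0 /=; first by rewrite EFinD.
rewrite -esumD; try by move=> a _; exact: word_sum_ge0.
by apply: eq_esum => a _; exact: IH.
Qed.

Lemma word_sum_sum n (J : Type) (s : seq J) (F : J -> seq I -> R) :
  (forall j w, 0 <= F j w) ->
  word_sum n (fun w => \sum_(j <- s) F j w) =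
  (\sum_(j <- s) word_sum n (F j))%E.
Proof.
move=> F0; elim: s => [|j s IH].
  rewrite big_nil; under [X in word_sum n X]funext => w do rewrite big_nil.
  by elim: n => //= n IH; rewrite esum1.
rewrite big_cons -IH -word_sumD//; last by move=> w; exact: sumr_ge0.
by congr word_sum; apply/funext => w; rewrite big_cons.
Qed.

(* The words shorter than [n] are kept whole by [take n]. *)
Lemma word_sum_cat_le n N (g h : seq I -> R) :
  (forall w, 0 <= g w) -> (forall w, 0 <= h w) ->
  (forall m, word_sum m h <= 1)%E ->
  (word_sum N (fun w => g (take n w) * h (drop n w))%R <=
   word_sum (minn n N) g)%E.
Proof.
move=> g0 h0 h1; elim: n N g g0 => [|n IH] N g g0.
  rewrite min0n /=; under [X in word_sum N X]funext => w do rewrite take0 drop0.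
  apply: le_trans (word_sumZ_le _ (g0 _) h0) _.
  by rewrite -[leRHS]mule1; apply: lee_wpmul2l; rewrite ?lee_fin.
case: N => [|N] /=; last by rewrite minnSS /=; apply: le_esum => a _; exact: IH.
rewrite EFinM -[leRHS]mule1; apply: lee_wpmul2l; first by rewrite lee_fin.
exact: (h1 0%N).
Qed.
End OneAlphabet.

End WordSums.


(** * Kraft sums and the probabilities of names *)

Section Coding.
Context d (X : measurableType d) (R : realType).
Variables (mu : probability X R) (tau : X -> X).
Hypothesis mtau : measurable_fun setT tau.

Lemma measurable_iter n : measurable_fun setT (iter n tau).
Proof.
elim: n => [|n IH] /=; first exact: measurable_id.
exact: (measurableT_comp mtau IH).
Qed.

Lemma label_iter (I : Type) (f : X -> I) n : label f -> label (f \o iter n tau).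
Proof.
by move=> lf i; rewrite comp_preimage -[_ @^-1` _]setTI; exact: measurable_iter.
Qed.

Lemma label_name (I : countType) (phi : X -> I) n :
  label phi -> label (name tau phi n).
Proof.
move=> lphi; elim: n => [|n IH] w /=.
  have [->|w0] := eqVneq w [::].
    by rewrite (_ : _ @^-1` _ = setT)//; apply/seteqP; split=> x.
  rewrite (_ : _ @^-1` _ = set0)//; apply/seteqP; split=> [x /= e|//].
  by rewrite -e eqxx in w0.
pose g (p : I * seq I) := p.1 :: p.2.
have := label_comp g (label_pair lphi (@label_iter _ _ 1 IH)); exact.
Qed.

(* [word_sum n F] is the Kraft sum of the code [F], of cost [- ln F]. *)
Lemma integral_code (I : countType) (phi : X -> I) n (E : set X) (j : nat)
    (F : seq I -> R) : label phi -> measurable E -> (forall w, 0 <= F w) ->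
  (\int[mu]_(x in E) ((F (name tau phi n (iter j tau x)) /
     fine (mu (E `&` [set y | name tau phi n (iter j tau y) =
                              name tau phi n (iter j tau x)])))%R)%:E
   <= word_sum n F)%E.
Proof.
move=> lphi; elim: n E j F => [|n IH] E j F mE F0 /=.
  have nilT : [set _ : X | [::] = [::] :> seq I] = setT by exact/seteqP.
  under eq_integral do rewrite nilT setIT.
  rewrite integral_cst_prob// lee_fin.
  (* On a null [E] the quotient takes the default value [0]; this is one reason why only an
     inequality is claimed. *)
  have [->|m0] := eqVneq (fine (mu E)) 0; first by rewrite mulr0.
  by rewrite divfK.
have lphij := label_iter j lphi.
have lnm k i := label_iter i (label_name k lphi).
rewrite (integral_label mu lphij mE); last first.
- by move=> x _; rewrite lee_fin divr_ge0// fine_ge0.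
- apply: measurable_funTS; apply/measurable_EFinP.
  pose G w := F w / fine (mu (E `&` [set y | name tau phi n.+1 (iter j tau y) = w])).
  exact: (label_measurable_fun G (lnm n.+1 j)).
apply: le_esum => a _.
(* [E] and [j] are general for the sake of this step: the induction hypothesis is applied to the
   points of [E] that read [a] at time [j], and to the names that start at time [j.+1]. *)
have mEa : measurable (E `&` (phi \o iter j tau) @^-1` [set a]).
  exact: measurableI.
have := IH _ j.+1 (fun v => F (a :: v)) mEa (fun v => F0 _).
rewrite (eq_integral (fun x => (F (phi (iter j tau x) :: name tau phi n (tau (iter j tau x))) /
  fine (mu (E `&` [set y |
    phi (iter j tau y) :: name tau phi n (tau (iter j tau y)) =
    phi (iter j tau x) :: name tau phi n (tau (iter j tau x))])))%:E))//.
move=> x; rewrite inE => -[_ /= ->]; congr ((_ / fine (mu _))%:E).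
rewrite -setIA; congr (_ `&` _); apply/seteqP; split=> y /=; first by case=> -> ->.
by case=> -> ->.
Qed.

Lemma integral_code_prob (I : countType) (phi : X -> I) n (F : seq I -> R) :
  label phi -> (forall w, 0 <= F w) ->
  (\int[mu]_x (F (name tau phi n x) / prob mu (name tau phi n) x)%R%:E
   <= word_sum n F)%E.
Proof.
move=> lphi F0; have := integral_code n 0 lphi measurableT F0.
by under eq_integral do rewrite setTI.
Qed.

(** The length is read off [w], so that a single weight on words serves the blocks of all lengths in
    [parse_code]. *)
Lemma word_sum_mass (I : countType) (phi : X -> I) n :
  label phi ->
  (word_sum n (fun w => fine (mu [set x | name tau phi (size w) x = w])) <= 1)%E.
Proof.
move=> lphi.
have key (E : set X) j : measurable E ->
    (word_sum n (fun w => fine (mu (E `&` [set x |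
      name tau phi (size w) (iter j tau x) = w]))) <= mu E)%E.
  elim: n E j => [|n IH] E j mE /=.
    have -> : [set _ : X | [::] = [::] :> seq I] = setT by exact/seteqP.
    by rewrite setIT fine_probE.
  have lphij := label_iter j lphi.
  rewrite (measure_label mu lphij mE); apply: le_esum => a _.
  have mEa : measurable (E `&` (phi \o iter j tau) @^-1` [set a]).
    exact: measurableI.
  apply: le_trans (IH _ j.+1 mEa); apply: le_word_sum => w.
  rewrite (_ : E `&` _ = (E `&` (phi \o iter j tau) @^-1` [set a]) `&`
     [set x | name tau phi (size w) (iter j.+1 tau x) = w])//.
  by rewrite -setIA; congr (_ `&` _); apply/seteqP; split=> y /= => -[-> ->].
have := key setT 0%N measurableT; rewrite probability_setT.
by under [X in word_sum n X]funext => w do rewrite setTI.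
Qed.

End Coding.


(** * Codes that cut words into blocks *)

Section ParseCode.
Variables (R : realType) (I : choiceType) (m : seq I -> R) (M : nat).
Hypotheses (m0 : forall w, 0 <= m w) (m1 : forall n, (word_sum n m <= 1)%E).

(** A distribution on the positive integers whose sum telescopes. Announcing the length [n] costs
    about [2 ln n], which is below [e * n] for long blocks. *)
Definition block_weight (n : nat) : R := (n * n.+1)%:R^-1.

(* The words are cut in blocks of lengths between 1 and [M] in all possible
   ways; a block of length [n] receives the weight [block_weight n] and the
   probability [m].  The last block may be truncated by the end of the word. *)
Fixpoint parse_code (f : nat) (v : seq I) : R :=
  if v is [::] then 1 else if f isn't g.+1 then 0 else
  \sum_(1 <= n < M.+1)
     block_weight n * (m (take n v) * parse_code g (drop n v)).

Lemma block_weight_ge0 n : 0 <= block_weight n.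
Proof. by rewrite invr_ge0 ler0n. Qed.

Lemma sum_block_weight_le1 : \sum_(1 <= n < M.+1) block_weight n <= 1.
Proof.
suff -> : \sum_(1 <= n < M.+1) block_weight n = 1 - M.+1%:R^-1.
  by rewrite gerBl invr_ge0 ler0n.
elim: M => [|k IH]; first by rewrite big_geq// invr1 subrr.
rewrite big_nat_recr//= IH /block_weight natrM -!natr1.
have : 0 <= (k%:R : R) by rewrite ler0n.
by move=> k0; field; apply/andP; split; apply: lt0r_neq0; lra.
Qed.

Lemma parse_code_ge0 f v : 0 <= parse_code f v.
Proof.
elim: f v => [|f IH] [|a v] //=; apply: sumr_ge0 => n _.
by rewrite !mulr_ge0// block_weight_ge0.
Qed.

Lemma parse_code_nil f : parse_code f [::] = 1. Proof. by case: f. Qed.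

Lemma parse_code_ge f n v : (0 < n <= M)%N -> (0 < size v)%N ->
  block_weight n * (m (take n v) * parse_code f (drop n v)) <=
  parse_code f.+1 v.
Proof.
case: v => // a v /andP[n0 nM] _ /=.
rewrite (bigD1_seq n)/= ?iota_uniq//; last by rewrite mem_index_iota n0.
rewrite lerDl sumr_ge0// => k _.
by rewrite !mulr_ge0// ?block_weight_ge0// parse_code_ge0.
Qed.

(** For a fixed length of the first block, the block and the rest of the word have Kraft sums at
    most [1]; the weights of the lengths add up to at most [1]. A truncated block does no harm
    because [m] has Kraft sum at most [1] at every length. *)
Lemma word_sum_parse_code f n : (word_sum n (parse_code f) <= 1)%E.
Proof.
elim: f n => [|f IH] [|n] //.
  by rewrite /= esum1// => a _; elim: n => //= n IH; rewrite esum1.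
have -> : word_sum n.+1 (parse_code f.+1) =
    word_sum n.+1 (fun v => \sum_(1 <= k < M.+1)
     block_weight k * (m (take k v) * parse_code f (drop k v)))%R by [].
rewrite word_sum_sum; last first.
  by move=> k w; rewrite !mulr_ge0// ?block_weight_ge0// parse_code_ge0.
apply: (@le_trans _ _ (\sum_(1 <= k < M.+1) (block_weight k)%:E)%E); last first.
  by rewrite sumEFin lee_fin sum_block_weight_le1.
apply: lee_sum => k _.
apply: le_trans (word_sumZ_le _ (block_weight_ge0 _) _) _.
  by move=> w; rewrite mulr_ge0// parse_code_ge0.
rewrite -[leRHS]mule1; apply: lee_wpmul2l; first by rewrite lee_fin block_weight_ge0.
by apply: le_trans (word_sum_cat_le _ _ m0 (parse_code_ge0 f) (IH)) (m1 _).
Qed.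

Variables (X : Type) (tau : X -> X) (psi : X -> I).
Variables (c e kappa : R) (n0 : nat) (good : set X) (G : X -> R).
Hypotheses (c0 : 0 <= c) (e0 : 0 <= e) (n0_gt0 : (0 < n0)%N) (M0 : (0 < M)%N).
Hypothesis weight_ge : forall n, (n0 <= n)%N -> expR (- (e * n%:R)) <= block_weight n.
Hypothesis kappa0 : 0 < kappa.
Hypothesis m_nonincr : forall n k x, (k <= n)%N ->
  m (name tau psi n x) <= m (name tau psi k x).
Hypothesis goodP : forall x, good x -> exists2 n, (n0 <= n <= M)%N &
  expR (- (c * n%:R)) <= m (name tau psi n x).
Hypothesis G0 : forall x, 0 <= G x.
Hypothesis G_bad : forall x, ~ good x -> G x = - ln (kappa / 2).

(** All terms of the code are nonnegative, so one way of cutting gives a lower bound. The greedy cut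
    takes a good block of length [k] where one starts, at cost at most [k * (c + e)], and a single
    letter elsewhere, at cost at most [- ln (kappa / 2)], where [1 / 2] is [block_weight 1]. The
    reserve [M * (c + e)] pays for a last block that overruns the end. Every block uses up a letter,
    so fuel [n] suffices. *)
Lemma parse_code_lower f n x : (n <= f)%N ->
  (forall j, kappa <= m (name tau psi 1 (iter j tau x))) ->
  expR (- (n%:R * (c + e) + \sum_(j < n) G (iter j tau x) + M%:R * (c + e))) <=
  parse_code f (name tau psi n x).
Proof.
have ce0 : 0 <= c + e by rewrite addr_ge0.
have Mce : 0 <= M%:R * (c + e) by rewrite mulr_ge0.
elim: f n x => [|f IH] [|n] x // nf kx.
- by rewrite big_ord0 mul0r -[leRHS]expR0 ler_expR; lra.
- by rewrite big_ord0 mul0r -[leRHS]expR0 ler_expR; lra.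
have [gx|bx] := pselect (good x).
  have [k /andP[n0k kM] mk] := goodP gx.
  have k0 : (0 < k)%N by exact: leq_trans n0k.
  have := @parse_code_ge f k (name tau psi n.+1 x); rewrite k0 kM size_name.
  move=> /(_ isT isT); apply: le_trans; rewrite drop_name.
  have [kn|nk] := leqP k n.+1.
    rewrite take_name//.
    have kx' j : kappa <= m (name tau psi 1 (iter j tau (iter k tau x))).
      by rewrite -iterD.
    have nkf : (n.+1 - k <= f)%N by lia.
    have {}IH := IH _ _ nkf kx'.
    have := ler_pM (expR_ge0 _) (expR_ge0 _) mk IH; rewrite -expRD => mIH.
    have := ler_pM (expR_ge0 _) (expR_ge0 _) (weight_ge n0k) mIH.
    rewrite -expRD; apply: le_trans; rewrite ler_expR.
    rewrite natrB//.
    have : \sum_(j < n.+1 - k) G (iter j tau (iter k tau x)) <=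
           \sum_(j < n.+1) G (iter j tau x).
      rewrite -(big_mkord xpredT (fun j => G (iter j tau x))) (big_cat_nat _ kn)//=.
      have -> : \sum_(k <= i < n.+1) G (iter i tau x) =
          \sum_(j < n.+1 - k) G (iter j tau (iter k tau x)).
        rewrite -{1}[k]add0n big_addn big_mkord.
        by apply: eq_bigr => j _; rewrite iterD.
      by rewrite lerDr sumr_ge0.
    by move=> h; nra.
  (* The block overruns the end of the word: its truncation is at least as probable by [m_nonincr],
     and its cost is covered by the reserve. *)
  have -> : name tau psi (n.+1 - k) (iter k tau x) = [::].
    by have -> : (n.+1 - k = 0)%N by lia.
  rewrite parse_code_nil mulr1 take_oversize ?size_name ?(ltnW nk)//.
  have mk' := le_trans mk (m_nonincr x (ltnW nk)).
  have := ler_pM (expR_ge0 _) (expR_ge0 _) (weight_ge n0k) mk'.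
  rewrite -expRD; apply: le_trans; rewrite ler_expR.
  have : k%:R <= M%:R :> R by rewrite ler_nat.
  have : 0 <= \sum_(j < n.+1) G (iter j tau x) by rewrite sumr_ge0.
  have : 0 <= n.+1%:R * (c + e) by rewrite mulr_ge0.
  by move=> *; nra.
have := @parse_code_ge f 1 (name tau psi n.+1 x); rewrite M0 size_name.
move=> /(_ isT isT); apply: le_trans.
rewrite take_name// drop_name subn1.
have kx' j : kappa <= m (name tau psi 1 (iter j tau (iter 1 tau x))).
  by rewrite -iterD.
have {}IH := IH n (iter 1 tau x) nf kx'.
have := ler_pM (ltW kappa0) (expR_ge0 _) (kx 0%N) IH => /= mIH.
have w1 : block_weight 1 = 2^-1 by [].
rewrite w1; apply: le_trans (ler_wpM2l _ mIH); last by rewrite invr_ge0.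
rewrite mulrA (mulrC 2^-1).
have k2 : 0 < kappa / 2 by rewrite divr_gt0.
rewrite -[kappa / 2]lnK ?posrE// -expRD ler_expR.
rewrite big_ord_recl /= (G_bad bx) -natr1.
set S := \sum_(j < n) G (tau (iter _ _ _)).
have -> : \sum_(j < n) G (iter j tau (tau x)) = S.
  by apply: eq_bigr => j _; rewrite -iterSr.
lra.
Qed.

End ParseCode.

(** * Transmission of one labelling given another *)

Section NoiseCode.
Variables (R : realType) (I : choiceType) (eta : R) (pi : I -> R).
Hypotheses (eta01 : 0 <= eta <= 1) (pi0 : forall b, 0 <= pi b).
Hypothesis pi1 : (\esum_(b in [set: I]) (pi b)%:E <= 1)%E.

(* A letter [(a, b)] pairs a letter [a] already known with the one to be coded:
   [b] repeats [a] with probability [1 - eta] and is drawn from [pi] otherwise. *)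
Definition noise (p : I * I) : R := (1 - eta) * (p.2 == p.1)%:R + eta * pi p.2.

Lemma noise_ge0 p : 0 <= noise p.
Proof.
case/andP: eta01 => e0 e1; rewrite /noise addr_ge0// mulr_ge0//.
by rewrite subr_ge0.
Qed.

Lemma sum_noise_le1 a : (\esum_(b in [set: I]) (noise (a, b))%:E <= 1)%E.
Proof.
case/andP: eta01 => e0 e1; have e1' : 0 <= 1 - eta by lra.
rewrite /noise /=; under eq_esum => b _ do rewrite EFinD 2!EFinM.
rewrite esumD; last 2 first.
- by move=> b _; rewrite mule_ge0// lee_fin// e1'.
- by move=> b _; rewrite mule_ge0// lee_fin.
apply: (@le_trans _ _ ((1 - eta)%:E + eta%:E)%E); last first.
  by rewrite -EFinD subrK.
apply: leeD.
  apply: le_trans (esumZl_le e1' _) _; first by move=> b; rewrite lee_fin.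
  have -> : (\esum_(b in [set: I]) (b == a)%:R%:E = 1 :> \bar R)%E.
    transitivity (\esum_(b in [set a]) ((b == a)%:R%:E : \bar R)).
      rewrite [RHS]esum_mkcond; apply: eq_esum => b _; rewrite in_set1.
      by case: eqP.
    by rewrite esum_set1 ?eqxx// lee_fin.
  by rewrite mule1.
apply: le_trans (esumZl_le e0 _) _; first by move=> b; rewrite lee_fin.
by rewrite -[leRHS]mule1; apply: lee_wpmul2l; rewrite ?lee_fin.
Qed.

(** Given the first coordinates, the noise weights of the second ones form a sub-probability;
    summing these out leaves the Kraft sum of [F]. *)
Lemma word_sum_noise n (F : seq I -> R) : (forall w, 0 <= F w) ->
  (word_sum n (fun w => F (map fst w) * \prod_(p <- w) noise p)%R <=
   word_sum n F)%E.
Proof.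
have P0 w : 0 <= \prod_(p <- w) noise p by apply: prodr_ge0 => p _; exact: noise_ge0.
elim: n F => [|n IH] F F0 /=; first by rewrite big_nil mulr1.
apply: (@le_trans _ _ (\esum_(p in [set: I * I])
    ((noise p)%:E * word_sum n (fun v => F (p.1 :: v))))%E).
  apply: le_esum => p _.
  have := @word_sumZ_le R _ n (noise p)
    (fun v => F (p.1 :: map fst v) * \prod_(p <- v) noise p) (noise_ge0 p).
  move=> h; rewrite (_ : (fun v => _) = fun v => noise p *
      (F (p.1 :: map fst v) * \prod_(q <- v) noise q)); last first.
    by apply/funext => v; rewrite big_cons mulrCA.
  apply: le_trans (h _) _ => [w|]; first by rewrite mulr_ge0.
  apply: lee_wpmul2l; first by rewrite lee_fin noise_ge0.
  exact: (IH (fun v => F (p.1 :: v))).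
have W0 a : (0 <= word_sum n (fun v => F (a :: v)))%E by exact: word_sum_ge0.
apply: le_trans (esum_pair_le _) _.
  by move=> p; rewrite mule_ge0// lee_fin noise_ge0.
apply: le_esum => a _ /=.
case: (word_sum n _) (W0 a) => [r|_|//]; last by rewrite leey.
rewrite lee_fin => r0; under eq_esum => b _ do rewrite muleC.
apply: le_trans (esumZl_le r0 _) _; first by move=> b; rewrite lee_fin noise_ge0.
by rewrite -[leRHS]mule1; apply: lee_wpmul2l; rewrite ?lee_fin ?sum_noise_le1.
Qed.

End NoiseCode.


(** * Measure-preserving and ergodic maps *)

Section ProbabilitySpace.
Context d (X : measurableType d) (R : realType).
Variable mu : probability X R.

Lemma measure_exhaust (F : nat -> set X) (e : R) :
  (forall n, measurable (F n)) -> (forall m n, (m <= n)%N -> F m `<=` F n) ->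
  mu (\bigcup_n F n) = 1%E -> 0 < e ->
  exists M, forall m, (M <= m)%N -> (mu (~` F m) <= e%:E)%E.
Proof.
move=> mF ndF F1 e0.
have mUF : measurable (\bigcup_n F n) by exact: bigcup_measurable.
have hF : {homo F : n m / (n <= m)%N >-> (n <= m)%O}.
  by move=> n m nm; apply/subsetPset; exact: ndF.
have cF : (mu \o F) n @[n --> \oo] --> (1 : R)%:E.
  by rewrite -[_%:E]F1; exact: (nondecreasing_cvg_mu (mu := mu) mF mUF hF).
have [] := @cvgr_gt _ _ _ _ _ _ (fine_cvg cF) (1 - e); first by rewrite /= gtrBl.
move=> M _ hM; exists M => m Mm; have /= := hM m Mm.
rewrite probability_setC// -(fine_probE mu (mF m)) -EFinB lee_fin => h; lra.
Qed.

Lemma abs_cont_integral (f : X -> R) (e : R) :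
  measurable_fun setT f -> (forall x, 0 <= f x) -> (\int[mu]_x (f x)%:E < +oo)%E ->
  0 < e -> exists2 de : R, 0 < de & forall A, measurable A ->
    (mu A <= de%:E)%E -> (\int[mu]_x (\1_A x * f x)%:E <= e%:E)%E.
Proof.
move=> mf f0 If e0.
have intf : mu.-integrable setT (EFin \o f).
  apply/integrableP; split; first exact/measurable_EFinP.
  by under eq_integral do rewrite /= ger0_norm//.
have [de [de0 H]] := integral_normr_continuous intf e0.
exists (de / 2) => [|A mA muA]; first by rewrite divr_gt0.
have muA' : (mu A < de%:E)%E.
  by apply: le_lt_trans muA _; rewrite lte_fin; lra.
have := H A mA muA'; rewrite /Rintegral => /ltW h.
rewrite (_ : \int[mu]_x _ = \int[mu]_(x in A) (`|f x|)%:E)%E; last first.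
  rewrite [RHS]integral_mkcond; apply: eq_integral => x _.
  by rewrite patchE indicE; case: ifP => _; rewrite ?mul1r ?mul0r ?ger0_norm.
rewrite -(@fineK _ (\int[mu]_(x in A) _)%E) ?lee_fin//.
rewrite ge0_fin_numE; last by apply: integral_ge0 => x _; rewrite lee_fin.
apply: le_lt_trans If; under eq_integral do rewrite ger0_norm//.
by apply: ge0_subset_integral => //; [exact/measurable_EFinP|move=> x _; rewrite lee_fin].
Qed.

End ProbabilitySpace.


Section Dynamics.
Context d (X : measurableType d) (R : realType).
Variables (mu : probability X R) (tau : X -> X).
Hypothesis mtau : measurable_fun setT tau.
Hypothesis inv_tau : forall E, measurable E -> mu (tau @^-1` E) = mu E.

Lemma measurable_preimage_iter n E :
  measurable E -> measurable (iter n tau @^-1` E).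
Proof. by move=> mE; rewrite -[_ @^-1` _]setTI; exact: measurable_iter. Qed.

Lemma measure_preimage_iter n E :
  measurable E -> mu (iter n tau @^-1` E) = mu E.
Proof.
move=> mE; elim: n => [|n IH]; first by congr (mu _); apply/seteqP.
rewrite -IH -(inv_tau (measurable_preimage_iter n mE)).
by congr (mu _); apply/seteqP; split=> x /=; rewrite -iterS iterSr.
Qed.

Lemma ae_iter (P : set X) :
  {ae mu, forall x, P x} -> {ae mu, forall x, forall j, P (iter j tau x)}.
Proof.
move=> [N [mN N0 PN]]; apply: ae_foralln => j.
exists (iter j tau @^-1` N); split; first exact: measurable_preimage_iter.
- by rewrite -N0; exact: measure_preimage_iter.
- by move=> x /= h; exact: PN.
Qed.

Lemma integral_iter n (f : X -> \bar R) : measurable_fun setT f ->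
  (forall x, 0 <= f x)%E ->
  (\int[mu]_x f (iter n tau x) = \int[mu]_x f x)%E.
Proof.
move=> mf f0.
have := @ge0_integral_pushforward _ _ X X R _ (measurable_iter mtau n) mu setT f
  measurableT mf (fun y _ => f0 y).
rewrite preimage_setT => <-; apply: eq_measure_integral => [|mi A mA _].
  exact: measurable_iter.
exact: measure_preimage_iter.
Qed.

Definition orbit_sum (f : X -> R) (n : nat) (x : X) : R :=
  \sum_(j < n) f (iter j tau x).

Lemma orbit_sum_ge0 f n x : (forall y, 0 <= f y) -> 0 <= orbit_sum f n x.
Proof. by move=> f0; apply: sumr_ge0. Qed.

Lemma orbit_sumD f k n x : (k <= n)%N ->
  orbit_sum f n x = orbit_sum f k x + orbit_sum f (n - k) (iter k tau x).
Proof.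
move=> kn; rewrite /orbit_sum -(big_mkord xpredT (fun j => f (iter j tau x))).
rewrite (big_cat_nat _ kn)//= big_mkord; congr (_ + _).
rewrite -{1}[k]add0n big_addn big_mkord.
by apply: eq_bigr => j _; rewrite iterD.
Qed.

Lemma orbit_sumS f n x : orbit_sum f n.+1 x = f x + orbit_sum f n (tau x).
Proof. by rewrite (orbit_sumD _ _ (ltn0Sn n)) subn1 /orbit_sum big_ord1. Qed.

Lemma measurable_orbit_sum (f : X -> R) n : measurable_fun setT f ->
  measurable_fun setT (orbit_sum f n).
Proof.
move=> mf; apply: measurable_sum => j.
exact: measurableT_comp mf (measurable_iter mtau _).
Qed.

Lemma integral_orbit_sum (f : X -> R) n : measurable_fun setT f -> (forall x, 0 <= f x) ->
  (\int[mu]_x (orbit_sum f n x)%:E = n%:R%:E * \int[mu]_x (f x)%:E)%E.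
Proof.
move=> mf f0; rewrite /orbit_sum; under eq_integral do rewrite -sumEFin.
rewrite ge0_integral_sum//; last 2 first.
- move=> j; apply/measurable_EFinP.
  exact: measurableT_comp mf (measurable_iter mtau _).
- by move=> j x _; rewrite lee_fin.
rewrite (eq_bigr (fun=> \int[mu]_x (f x)%:E))%E; last first.
  move=> j _; rewrite (integral_iter j (f := EFin \o f))//.
  exact/measurable_EFinP.
elim: n => [|n IH]; first by rewrite big_ord0 mul0e.
by rewrite big_ord_recl IH -add1n natrD EFinD ge0_muleDl ?mul1e// lee_fin.
Qed.

(* Cutting the orbit greedily at the points of [E] into pieces over which [f]
   averages at least [t] bounds the visits to [E] by the orbit sum of [f]. *)
Lemma greedy_orbit_bound (f : X -> R) (E : set X) (t : R) (M n : nat) x :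
  (forall x, 0 <= f x) -> 0 <= t ->
  (forall x, E x -> exists2 k, (0 < k <= M)%N & t * k%:R <= orbit_sum f k x) ->
  t * orbit_sum \1_E n x <= orbit_sum f n x + t * M%:R.
Proof.
move=> f0 t0 hE; elim/ltn_ind: n x => -[_ x|n IH x].
  by rewrite /orbit_sum !big_ord0 mulr0 add0r mulr_ge0.
have visits k y : orbit_sum \1_E k y <= k%:R.
  rewrite /orbit_sum -[k in leRHS]card_ord -sumr_const; apply: ler_sum => j _.
  by rewrite indicE; case: (_ \in _).
have [Ex|nEx] := pselect (E x); last first.
  rewrite !orbit_sumS indicE memNset// add0r.
  by apply: le_trans (IH n (ltnSn n) (tau x)) _; rewrite -addrA lerDr.
have [k /andP[k0 kM] hk] := hE x Ex.
have [kn|nk] := leqP k n.+1; last first.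
  apply: (@le_trans _ _ (t * M%:R)); last by rewrite lerDr orbit_sum_ge0.
  apply: ler_wpM2l => //; apply: le_trans (visits _ _) _.
  by rewrite ler_nat (leq_trans (ltnW nk)).
rewrite !(orbit_sumD _ x kn).
have nk : (n.+1 - k < n.+1)%N by lia.
have := IH _ nk (iter k tau x); have := ler_wpM2l t0 (visits k x); lra.
Qed.

(** Fix a bound [M] on the lengths of the averages. Integrating [greedy_orbit_bound] over orbits of
    length [n], invariance multiplies both main terms by [n], while the boundary term [t * M] stays
    fixed and disappears as [n] grows. Then [M] tends to infinity. *)
Lemma maximal_inequality (f : X -> R) (t : R) :
  measurable_fun setT f -> (forall x, 0 <= f x) -> 0 < t ->
  (t%:E * mu (\bigcup_k [set x | (0 < k)%N /\ t * k%:R <= orbit_sum f k x]%R) <=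
   \int[mu]_x (f x)%:E)%E.
Proof.
move=> mf f0 t0; set I := (\int[mu]_x _)%E.
have [Iy|] := eqVneq I +oo%E; first by rewrite Iy leey.
have I0 : (0 <= I)%E by apply: integral_ge0 => x _; rewrite lee_fin.
rewrite -ltey => Ify; have If : I \is a fin_num by rewrite ge0_fin_numE.
pose A k := [set x | (0 < k)%N /\ t * k%:R <= orbit_sum f k x].
have mA k : measurable (A k).
  have [->|k0] := posnP k.
    by rewrite (_ : A 0%N = set0)//; apply/seteqP; split=> x [].
  rewrite (_ : A k = setT `&` orbit_sum f k @^-1` `[t * k%:R, +oo[).
    by apply: measurable_orbit_sum => //.
  by apply/seteqP; split=> x /=; rewrite in_itv /= andbT => -[].
pose E M := \bigcup_(k in [set k | (k <= M)%N]) A k.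
have mE M : measurable (E M) by exact: bigcup_measurable.
have i0 M y : 0 <= \1_(E M) y :> R by rewrite indicE.
have EM M : (t%:E * mu (E M) <= I)%E.
  have finE := fine_probE mu (mE M).
  rewrite -finE -(fineK If) -EFinM lee_fin; set q := fine (mu _).
  have bnd n : t * (n%:R * q) <= n%:R * fine I + t * M%:R.
    have : (\int[mu]_x (t * orbit_sum \1_(E M) n x)%:E <=
            \int[mu]_x (orbit_sum f n x + t * M%:R)%:E)%E.
      apply: ge0_le_integral => //.
      - move=> x _; rewrite lee_fin; apply: mulr_ge0; first exact: ltW.
        exact: orbit_sum_ge0.
      - apply/measurable_EFinP; apply: measurable_funM => //.
        exact: measurable_orbit_sum.
      - apply/measurable_EFinP; apply: measurable_funD => //.
        exact: measurable_orbit_sum.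
      move=> x _; rewrite lee_fin; apply: greedy_orbit_bound => //.
        exact: ltW.
      by move=> y [k /= kM [k0 Ak]]; exists k; rewrite ?k0.
    under eq_integral do rewrite EFinM.
    rewrite ge0_integralZl//; last 3 first.
    - by apply/measurable_EFinP; exact: measurable_orbit_sum.
    - by move=> x _; rewrite lee_fin orbit_sum_ge0.
    - by rewrite lee_fin ltW.
    rewrite integral_orbit_sum//.
    under [X in (_ <= X)%E]eq_integral do rewrite EFinD.
    rewrite ge0_integralD//; last 3 first.
    - by move=> x _; rewrite lee_fin orbit_sum_ge0.
    - by apply/measurable_EFinP; exact: measurable_orbit_sum.
    - by move=> x _; rewrite lee_fin mulr_ge0// ltW.
    have I1 : (\int[mu]_x (\1_(E M) x)%:E = q%:E)%E.
      by rewrite integral_indic// setIT; exact/esym.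
    rewrite integral_orbit_sum// integral_cst_prob// I1 -/I -(fineK If).
    by rewrite probability_setT /= mulr1 -!EFinM -EFinD lee_fin.
  rewrite leNgt; apply/negP => lt; have dq : 0 < t * q - fine I by rewrite subr_gt0.
  have [n hn] : exists n : nat, t * M%:R / (t * q - fine I) < n%:R.
    by exists (Num.truncn (t * M%:R / (t * q - fine I))).+1; exact: truncnS_gt.
  move: hn; rewrite ltr_pdivrMr// => hn; have := bnd n; nra.
have -> : \bigcup_k A k = \bigcup_M E M.
  apply/seteqP; split=> x [k kM Akx]; first by exists k => //; exists k => //=.
  by case: Akx => l _ Al; exists l.
have mUE : measurable (\bigcup_M E M) by exact: bigcup_measurable.
have hE : {homo E : n m / (n <= m)%N >-> (n <= m)%O}.
  move=> n m nm; apply/subsetPset => x [k /= kn Ak]; exists k => //=.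
  exact: leq_trans nm.
have cE := nondecreasing_cvg_mu (mu := mu) mE mUE hE.
have ct : (t%:E * mu (E n) @[n --> \oo] --> t%:E * mu (\bigcup_M E M))%E.
  by apply: cvgeZl.
apply: (cvge_le _ ct) => //; exact: nearW.
Qed.

Hypothesis ergodic : forall E, measurable E -> tau @^-1` E = E ->
  (mu E = 0 \/ mu E = 1)%E.

(** The preimages of [E] increase and all have the measure of [E]; hence so does their union, which
    is exactly invariant. *)
Lemma ergodic_forward (E : set X) : measurable E -> E `<=` tau @^-1` E ->
  (mu E = 0 \/ mu E = 1)%E.
Proof.
move=> mE EE; pose F n := iter n tau @^-1` E.
have mF n : measurable (F n) by exact: measurable_preimage_iter.
have hF : {homo F : n m / (n <= m)%N >-> (n <= m)%O}.
  move=> n m nm; apply/subsetPset; rewrite -(subnK nm).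
  elim: (m - n)%N => // k IH x /IH; rewrite addSn /F /=; exact: EE.
have mU : measurable (\bigcup_n F n) by exact: bigcup_measurable.
have cF := nondecreasing_cvg_mu (mu := mu) mF mU hF.
have -> : (mu E = mu (\bigcup_n F n))%E.
  have cE : (mu \o F) n @[n --> \oo] --> mu E.
    rewrite (_ : mu \o F = cst (mu E)); first exact: cvg_cst.
    by apply/funext => n /=; exact: measure_preimage_iter.
  exact: (cvg_unique _ cE cF).
apply: ergodic => //; apply/seteqP; split=> x [n _].
  by rewrite /F /= => h; exists n.+1 => //; rewrite /F /= -iterS iterSr.
move=> h; exists n => //; have /subsetPset/(_ _ h) := hF n n.+1 (leqnSn n).
by rewrite /F /= -iterS iterSr.
Qed.

End Dynamics.


(** * The coding inequality *)

(** With [y = e / 3], [expR (e * n)] is the cube of [expR (y * n)], hence at least [(y * n) ^ 3].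
    This exceeds [2 * n ^ 2], and so [n * (n + 1)], once [n > 2 / y ^ 3]. *)
Lemma expR_block_weight (R : realType) (e : R) : 0 < e ->
  exists2 n0, (0 < n0)%N &
    forall n, (n0 <= n)%N -> expR (- (e * n%:R)) <= block_weight R n.
Proof.
move=> e0; pose y := e / 3; have y0 : 0 < y by rewrite divr_gt0.
exists (Num.truncn (2 / y ^+ 3)).+1 => // n n0n.
have hn : 2 / y ^+ 3 < n%:R.
  by apply: lt_le_trans (truncnS_gt _) _; rewrite ler_nat.
have n1 : (1 <= n%:R :> R) by rewrite ler1n; apply: leq_trans n0n.
rewrite /block_weight expRN lef_pV2 ?posrE ?expR_gt0//; last first.
  by rewrite ltr0n muln_gt0 (leq_trans _ n0n).
have e3 : expR (e * n%:R) = expR (y * n%:R) ^+ 3.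
  by rewrite -expRM_natl /y; congr expR; field.
have h1 : y * n%:R <= expR (y * n%:R).
  by apply: le_trans (expR_ge1Dx _); rewrite lerDr.
have h3 : (y * n%:R) ^+ 3 <= expR (e * n%:R).
  by rewrite e3 lerXn2r// ?nnegrE ?expR_ge0// mulr_ge0// ltW.
apply: le_trans h3; rewrite natrM -natr1.
move: hn; rewrite ltr_pdivrMr ?exprn_gt0// => hn.
rewrite exprMn; have n2 : 0 <= n%:R ^+ 2 :> R by rewrite exprn_ge0.
have h := ler_wpM2l n2 (ltW hn).
have -> : y ^+ 3 * n%:R ^+ 3 = n%:R ^+ 2 * (n%:R * y ^+ 3) :> R by ring.
by apply: le_trans h; rewrite expr2; nra.
Qed.

(** Source of [kappa]: a finite alphabet bounds the positive letter probabilities from below.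
    Letters of probability zero are left out, being met on a null set only. *)
Lemma min_positive (R : realType) (I : eqType) (s : seq I) (m : I -> R) :
  exists2 k : R, 0 < k <= 1 & forall a, a \in s -> 0 < m a -> k <= m a.
Proof.
elim: s => [|b s [k /andP[k0 k1] hk]]; first by exists 1; rewrite ?ltr01 ?lexx.
exists (if 0 < m b then Num.min k (m b) else k) => [|a].
  by case: ifP => mb0; rewrite ?lt_min ?ge_min k0 ?mb0 k1.
rewrite inE => /orP[/eqP ->|/hk{}hk] ma0; first by rewrite ma0 ge_min lexx orbT.
by case: ifP => _; rewrite ?ge_min hk.
Qed.

Section Core.
Context d (X : measurableType d) (R : realType).
Variables (mu : probability X R) (tau : X -> X).
Hypothesis mtau : measurable_fun setT tau.
Hypothesis inv_tau : forall E, measurable E -> mu (tau @^-1` E) = mu E.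
Variable I : countType.
Implicit Types phi psi : X -> I.

(** This says that [info <= c * n] for infinitely many [n], up to null cells: it bounds the lower
    limit of [info / n], and provides good prefixes longer than any prescribed [n0]. *)
Definition often (psi : X -> I) (c : R) (x : X) : Prop :=
  forall k, exists2 n, (k <= n)%N &
    expR (- (c * n%:R)) <= prob mu (name tau psi n) x.

Definition finite_range (psi : X -> I) := exists s : seq I, forall x, psi x \in s.

Lemma prob_name_le psi k n x : label psi -> (k <= n)%N ->
  prob mu (name tau psi n) x <= prob mu (name tau psi k) x.
Proof.
move=> lpsi kn; apply: prob_refine; try exact: label_name.
by move=> y; exact: eq_name_le.
Qed.

Lemma prob_name_mass psi n x :
  fine (mu [set y | name tau psi (size (name tau psi n x)) y = name tau psi n x])
  = prob mu (name tau psi n) x.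
Proof. by rewrite size_name. Qed.

Lemma sum_label_le1 phi : label phi ->
  (\esum_(b in [set: I]) (fine (mu (phi @^-1` [set b])))%:E <= 1)%E.
Proof.
move=> lphi; under eq_esum => b _ do rewrite fine_probE//.
rewrite -(probability_setT mu) (measure_label mu lphi measurableT).
by apply: le_esum => b _; rewrite setTI.
Qed.

(** The noise rate is tuned so that [1 - eta = expR (- e)]: agreement costs at most [e] per letter.
    A disagreement costs at most [- ln eta] plus the information of the letter of [phi], which is
    what [g] records. *)
Lemma noise_product_lower phi psi (e : R) (g : X -> R) n x : 0 <= e ->
  let eta := 1 - expR (- e) in
  (forall y, g y = \1_[set y | phi y != psi y] y * (- ln eta + info mu phi y)) ->
  0 < eta ->
  (forall j, 0 < prob mu phi (iter j tau x)) ->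
  expR (- (n%:R * e + orbit_sum tau g n x)) <=
  \prod_(p <- name tau (fun y => (psi y, phi y)) n x)
     noise eta (fun b => fine (mu (phi @^-1` [set b]))) p.
Proof.
move=> e0 eta gE eta0; elim: n x => [|n IH] x px.
  by rewrite /= big_nil mul0r /orbit_sum big_ord0 addr0 oppr0 expR0.
rewrite /= big_cons orbit_sumS.
have px' j : 0 < prob mu phi (iter j tau (tau x)) by rewrite -iterSr.
have {}IH := IH _ px'.
have step : expR (- (e + g x)) <=
    noise eta (fun b => fine (mu (phi @^-1` [set b]))) (psi x, phi x).
  have q0 := px 0%N; rewrite /= in q0.
  have e1 : 1 - eta = expR (- e) by rewrite /eta subKr.
  rewrite /noise e1 /= gE indicE; have [xe|xne] := eqVneq (phi x) (psi x).
    rewrite memNset /= ?xe ?eqxx// mul0r addr0 mulr1 lerDl mulr_ge0 ?(ltW eta0)//.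
    exact: fine_prob_ge0.
  rewrite mem_set//= mul1r mulr0 add0r -/(prob mu phi x) (prob_expR q0).
  rewrite -{2}[eta]lnK ?posrE// -expRD ler_expR; lra.
have := ler_pM (expR_ge0 _) (expR_ge0 _) step IH.
by rewrite -expRD; apply: le_trans; rewrite ler_expR -natr1; lra.
Qed.

(* The bound [<= 1] is the Kraft inequality for a code of the [phi]-names whose
   cost is [n * (c + e)] up to a constant and to the errors collected by [G]:
   half of [e] pays for the lengths of the blocks, half for the absence of
   noise. *)
Lemma core_coding phi (e : R) : label phi ->
  (\int[mu]_x (info mu phi x)%:E < +oo)%E -> 0 < e ->
  exists2 de : R, 0 < de & forall psi (c : R), label psi -> finite_range psi ->
    (mu [set x | phi x != psi x] <= de%:E)%E -> 0 <= c ->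
    {ae mu, forall x, often psi c x} ->
  exists G : X -> R, exists2 K : R, [/\ 0 <= K, measurable_fun setT G, forall x, 0 <= G x &
      (\int[mu]_x (G x)%:E <= e%:E)%E] &
    forall n, (\int[mu]_x (expR (info mu (name tau phi n) x -
      (n%:R * (c + e) + orbit_sum tau G n x + K)))%:E <= 1)%E.
Proof.
move=> lphi Hphi e0; pose e2 := e / 2; have e20 : 0 < e2 by rewrite divr_gt0.
pose eta := 1 - expR (- e2).
have eta01 : 0 < eta < 1.
  by rewrite /eta subr_gt0 expR_lt1 oppr_lt0 e20 gtrBl expR_gt0.
have [eta0 eta1] := andP eta01.
have Leta : 0 <= - ln eta by rewrite oppr_ge0 ln_le0// ltW.
have f0 x : 0 <= - ln eta + info mu phi x by rewrite addr_ge0// info_ge0.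
have minfo := measurable_info mu lphi.
have mf : measurable_fun setT (fun x => - ln eta + info mu phi x).
  exact: measurable_funD.
have If : (\int[mu]_x (- ln eta + info mu phi x)%:E < +oo)%E.
  under eq_integral do rewrite EFinD.
  rewrite ge0_integralD//.
  - by rewrite integral_cst_prob// lte_add_pinfty// ltry.
  - by move=> x _; rewrite lee_fin info_ge0.
  - exact/measurable_EFinP.
(* The cost of a disagreement is integrable because [phi] has finite entropy, so absolute continuity
   of its integral tells how rare disagreements must be. *)
have [de de0 hde] := abs_cont_integral mf f0 If e20.
exists de => // psi c lpsi [s sP] mD c0 io.
set D := [set x | phi x != psi x] in mD.
have mDset : measurable D.
  exact: (label_preimage [set p : I * I | p.1 != p.2] (label_pair lphi lpsi)).
have {hde mD} gsmall := hde D mDset mD.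
pose g x := \1_D x * (- ln eta + info mu phi x).
have [n0 n0_gt0 hn0] := expR_block_weight e20.
pose m w := fine (mu [set x | name tau psi (size w) x = w]).
have [kappa /andP[k0 k1] hk] := min_positive [seq [:: a] | a <- s] m.
pose C := - ln (kappa / 2).
have C0 : 0 <= C by rewrite oppr_ge0 ln_le0//; lra.
pose good M := \bigcup_(n in [set n | (n0 <= n <= M)%N])
  [set x | expR (- (c * n%:R)) <= prob mu (name tau psi n) x].
have mgood M : measurable (good M).
  apply: bigcup_measurable => n _.
  exact: (label_preimage [set w | expR (- (c * n%:R)) <=
    fine (mu (name tau psi n @^-1` [set w]))] (label_name mtau n lpsi)).
have good1 : mu (\bigcup_M good M) = 1%E.
  have mU : measurable (\bigcup_M good M) by exact: bigcup_measurable.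
  have U0 : mu (~` \bigcup_M good M) = 0%E.
    apply/negligibleP; first exact: measurableC.
    apply: negligibleS io => x /= nU ox; apply: nU.
    have [n n0n hn] := ox n0; exists n => //; exists n => //=.
    by rewrite n0n leqnn.
  move: U0; rewrite probability_setC// -(fine_probE mu mU) -EFinB => -[].
  by move=> /eqP; rewrite subr_eq0 => /eqP <-.
(* Almost every point has a good prefix longer than [n0]. The cap [M] on its length leaves a bad set
   so small that letters sent alone, at cost [C] each, contribute at most [e2] on average; the
   denominator [C + 1] is positive since [C] is nonnegative. *)
have [M hM] : exists M, forall k, (M <= k)%N -> (mu (~` good k) <= (e2 / (C + 1))%:E)%E.
  apply: measure_exhaust => //; last by rewrite divr_gt0// ltr_wpDl.
  move=> i j ij x [n /= /andP[n0n ni] hn]; exists n => //=.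
  by rewrite n0n (leq_trans ni).
pose M' := maxn M 1.
have {hM} hM := hM M' (leq_maxl _ _).
have M'0 : (0 < M')%N by rewrite leq_max orbT.
pose B := ~` good M'.
have mB : measurable B by exact: measurableC.
pose G1 x := C * \1_B x.
have G10 x : 0 <= G1 x by rewrite mulr_ge0// indicE.
have g0 x : 0 <= g x by rewrite mulr_ge0// indicE.
have mg : measurable_fun setT g by apply: measurable_funM.
have mG1 : measurable_fun setT G1 by apply: measurable_funM.
exists (fun x => G1 x + g x), (M'%:R * (c + e2)).
  split.
  - by rewrite mulr_ge0// addr_ge0// ltW.
  - exact: measurable_funD.
  - by move=> x; rewrite addr_ge0.
  - under eq_integral do rewrite EFinD.
    have mEg : measurable_fun setT (EFin \o g) by exact/measurable_EFinP.
    have mEG1 : measurable_fun setT (EFin \o G1) by exact/measurable_EFinP.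
    have Eg0 x : (0 <= (g x)%:E)%E by rewrite lee_fin.
    have EG10 x : (0 <= (G1 x)%:E)%E by rewrite lee_fin.
    rewrite ge0_integralD//.
    rewrite [e in leRHS](_ : e = e2 + e2); last by rewrite /e2; field.
    rewrite EFinD leeD//.
    rewrite /G1; under eq_integral do rewrite EFinM.
    rewrite ge0_integralZl//; last first.
      exact/measurable_EFinP.
    rewrite integral_indic// setIT.
    apply: (@le_trans _ _ (C%:E * (e2 / (C + 1))%:E)%E).
      by apply: lee_wpmul2l; rewrite ?lee_fin.
    have C10 : 0 < C + 1 by lra.
    by rewrite -EFinM lee_fin mulrCA ler_piMr ?(ltW e20)// ler_pdivrMr ?mul1r//; lra.
move=> n; pose chi x := (psi x, phi x).
have lchi : label chi by exact: label_pair.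
have m0 w : 0 <= m w by exact: fine_prob_ge0.
have m1 k : (word_sum k m <= 1)%E by exact: word_sum_mass.
pose pi b := fine (mu (phi @^-1` [set b])).
(* The word of pairs is coded by its [psi]-part, cut into blocks, and then by its [phi]-part given
   the [psi]-part. *)
pose q w := parse_code m M' n (map fst w) * \prod_(p <- w) noise eta pi p.
have eta01' : 0 <= eta <= 1 by rewrite !ltW.
have pi0 b : 0 <= pi b by exact: fine_prob_ge0.
have q0 w : 0 <= q w.
  rewrite mulr_ge0// ?parse_code_ge0//; apply: prodr_ge0 => p _.
  exact: noise_ge0.
have q1 : (word_sum n q <= 1)%E.
  apply: le_trans (word_sum_noise eta01' pi0 (sum_label_le1 lphi) n _) _.
    by move=> w; exact: parse_code_ge0.
  exact: word_sum_parse_code.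
apply: le_trans (le_trans (integral_code_prob mu mtau n lchi q0) q1).
have lnphi k := label_name mtau k lphi.
have lnpsi k := label_name mtau k lpsi.
have lnchi k := label_name mtau k lchi.
apply: ae_ge0_le_integral => //.
- apply/measurable_EFinP; apply: (measurableT_comp (@measurable_expR R)).
  apply: measurable_funB; first exact: measurable_info.
  apply: measurable_funD => //; apply: measurable_funD => //.
  by apply: measurable_orbit_sum => //; exact: measurable_funD.
- by move=> x _; rewrite lee_fin divr_ge0// prob_ge0.
- apply/measurable_EFinP.
  exact: (label_measurable_fun (fun w => q w / fine (mu (name tau chi n @^-1` [set w])))).
have aephi := ae_iter mtau inv_tau (ae_prob_gt0 mu lphi).
have aepsi := ae_iter mtau inv_tau (ae_prob_gt0 mu (lnpsi 1%N)).
have aechi := ae_prob_gt0 mu (lnchi n).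
have aenphi := ae_prob_gt0 mu (lnphi n).
near=> x; have hphi : forall j, 0 < prob mu phi (iter j tau x) by near: x.
have hpsi : forall j, 0 < prob mu (name tau psi 1) (iter j tau x) by near: x.
have hchi : 0 < prob mu (name tau chi n) x by near: x.
have hnphi : 0 < prob mu (name tau phi n) x by near: x.
move=> _; rewrite lee_fin expRD (expR_info hnphi).
have qlow : expR (- (n%:R * (c + e) + orbit_sum tau (fun x => G1 x + g x) n x +
    M'%:R * (c + e2))) <= q (name tau chi n x).
  have noiselow := @noise_product_lower phi psi e2 g n x (ltW e20) (fun=> erefl) eta0 hphi.
  have kx j : kappa <= m (name tau psi 1 (iter j tau x)).
    apply: hk; first by apply/mapP; exists (psi (iter j tau x)).
    by rewrite /m prob_name_mass.
  have goodP y : good M' y -> exists2 k, (n0 <= k <= M')%N &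
      expR (- (c * k%:R)) <= m (name tau psi k y).
    by move=> [k /= kM hky]; exists k => //; rewrite /m prob_name_mass.
  have Gbad y : ~ good M' y -> G1 y = - ln (kappa / 2).
    by move=> by_; rewrite /G1 indicE mem_set// mulr1.
  have mnon k l y : (l <= k)%N -> m (name tau psi k y) <= m (name tau psi l y).
    by move=> lk; rewrite /m !prob_name_mass; exact: prob_name_le.
  have parselow := parse_code_lower m0 c0 (ltW e20) n0_gt0 M'0 hn0 k0 mnon goodP
    G10 Gbad (leqnn n) kx.
  have := ler_pM (expR_ge0 _) (expR_ge0 _) parselow noiselow.
  rewrite -expRD /q map_name -/(orbit_sum tau G1 n x); apply: le_trans.
  rewrite ler_expR.
  have -> : orbit_sum tau (fun x => G1 x + g x) n x =
      orbit_sum tau G1 n x + orbit_sum tau g n x by exact: big_split.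
  have -> : e = e2 + e2 by rewrite /e2; field.
  lra.
(* The code is one for pairs; forgetting [psi] enlarges the cells and so only lowers the
   information. *)
rewrite mulrC; apply: ler_pM => //; first by rewrite invr_ge0 ltW.
rewrite lef_pV2 ?posrE//; apply: prob_refine => // y.
by move=> /(congr1 (map snd)); rewrite !map_name.
Unshelve. all: by end_near.
Qed.

End Core.


(** * The Shannon-McMillan-Breiman theorem *)

Section ErealLimits.
Variable R : realType.
Implicit Types (u : nat -> \bar R) (l : \bar R).

Lemma ereal_cvg_sandwich u l :
  (forall c : R, (l < c%:E)%E -> \forall n \near \oo, (u n <= c%:E)%E) ->
  (forall c : R, (c%:E < l)%E -> \forall n \near \oo, (c%:E <= u n)%E) ->
  u n @[n --> \oo] --> l.
Proof.
case: l => [l| |] hu hl.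
- apply/fine_cvgP; split.
    have h1 := hu (l + 1); have h2 := hl (l - 1); near=> n.
    rewrite fin_numElt; apply/andP; split.
      apply: (@lt_le_trans _ _ (l - 1)%:E); first by rewrite ltNyr.
      by near: n; apply: h2; rewrite lte_fin; lra.
    apply: (@le_lt_trans _ _ (l + 1)%:E); last by rewrite ltry.
    by near: n; apply: h1; rewrite lte_fin; lra.
  apply/cvgrPdist_le => e e0; near=> n.
  have : (u n <= (l + e)%:E)%E by near: n; apply: hu; rewrite lte_fin; lra.
  have : ((l - e)%:E <= u n)%E by near: n; apply: hl; rewrite lte_fin; lra.
  rewrite /=; case: (u n) => [r|//|//] /=; rewrite !lee_fin => h1 h2.
  by rewrite ler_norml; apply/andP; split; lra.
- by apply/cvgeyPge => A; apply: hl; rewrite ltry.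
- by apply/cvgeNyPle => A; apply: hu; rewrite ltNyr.
Unshelve. all: by end_near.
Qed.

Lemma ereal_lt_between (a b : \bar R) : (a < b)%E ->
  exists c : R, (a < c%:E)%E /\ (c%:E < b)%E.
Proof.
case: a b => [a| |] [b| |] //= h.
- exists ((a + b) / 2); rewrite lte_fin in h; rewrite !lte_fin; split; lra.
- by exists (a + 1); rewrite lte_fin ltry; split => //; lra.
- by exists (b - 1); rewrite lte_fin ltNyr; split => //; lra.
- by exists 0; rewrite ltNyr ltry.
Qed.

(** The limit is the infimum of the eventual upper bounds: a real below it is not such a bound, so
    the dichotomy makes every smaller real an eventual lower bound. *)
Lemma ereal_cvg_dichotomy u :
  (forall a b : R, a < b -> (\forall n \near \oo, (u n <= b%:E)%E) \/
                            (\forall n \near \oo, (a%:E <= u n)%E)) ->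
  exists l, u n @[n --> \oo] --> l.
Proof.
move=> h; pose A := [set c%:E | c in [set c | \forall n \near \oo, (u n <= c%:E)%E]].
exists (ereal_inf A); apply: ereal_cvg_sandwich => c.
  move=> /ereal_inf_lt[_ [b hb <-] bc]; near=> n.
  by apply: le_trans (ltW bc); near: n; exact: hb.
move=> /ereal_lt_between[b [cb bl]]; rewrite lte_fin in cb.
have [hb|//] := h _ _ cb; exfalso.
have : (ereal_inf A <= b%:E)%E by apply: ereal_inf_lbound; exists b.
by rewrite leNgt bl.
Unshelve. all: by end_near.
Qed.

Lemma lim_le_near u l c : u n @[n --> \oo] --> l ->
  (\forall n \near \oo, (u n <= c)%E) -> (l <= c)%E.
Proof.
move=> cu ule; rewrite -(cvg_lim _ cu)//; apply: lime_le => //.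
by apply/cvg_ex; exists l.
Qed.

Lemma lim_ge_near u l c : u n @[n --> \oo] --> l ->
  (\forall n \near \oo, (c <= u n)%E) -> (c <= l)%E.
Proof.
move=> cu ule; rewrite -(cvg_lim _ cu)//; apply: lime_ge => //.
by apply/cvg_ex; exists l.
Qed.

Lemma geometric_sum_le (q : R) n : 0 <= q < 1 ->
  \sum_(0 <= k < n) q ^+ k <= (1 - q)^-1.
Proof.
move=> /andP[q0 q1]; have q1' : 0 < 1 - q by lra.
suff -> : \sum_(0 <= k < n) q ^+ k = (1 - q ^+ n) / (1 - q).
  rewrite ler_pdivrMr// mulVf ?gt_eqF//.
  by have := exprn_ge0 n q0; lra.
elim: n => [|n IH]; first by rewrite big_geq// expr0 subrr mul0r.
by rewrite big_nat_recr//= IH exprS; field; lra.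
Qed.
End ErealLimits.

Section Corollaries.
Context d (X : measurableType d) (R : realType).
Variables (mu : probability X R) (tau : X -> X).
Hypothesis mtau : measurable_fun setT tau.
Hypothesis inv_tau : forall E, measurable E -> mu (tau @^-1` E) = mu E.

Definition entropy_upto (I : countType) (phi : X -> I) (n : nat) : \bar R :=
  (\int[mu]_x (info mu (name tau phi n) x)%:E)%E.

Lemma entropy_upto_ge0 (I : countType) (phi : X -> I) n : label phi ->
  (0 <= entropy_upto phi n)%E.
Proof.
move=> lphi; apply: integral_ge0 => x _; rewrite lee_fin info_ge0//.
exact: label_name.
Qed.

Section Upper.
Variables (I : countType) (phi : X -> I).
Hypotheses (lphi : label phi) (Hphi : (\int[mu]_x (info mu phi x)%:E < +oo)%E).

(** Gibbs inequality: integrate [1 + x <= expR x] at [x = info - cost]. The exponential has integral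
    at most [1], which cancels the [1]; the errors integrate to at most [n * e2]. The terms are
    arranged so that all integrands are nonnegative. *)
Lemma entropy_upto_le (e : R) : 0 < e ->
  exists2 de : R, 0 < de & forall (psi : X -> I) (c : R), label psi -> finite_range psi ->
    (mu [set x | phi x != psi x] <= de%:E)%E -> 0 <= c ->
    {ae mu, forall x, often mu tau psi c x} ->
  exists K : R, forall n, (entropy_upto phi n <= (n%:R * (c + e) + K)%:E)%E.
Proof.
move=> e0; pose e2 := e / 2; have e20 : 0 < e2 by rewrite divr_gt0.
have [de de0 H] := core_coding mtau inv_tau lphi Hphi e20.
exists de => // psi c lpsi fpsi mD c0 io.
have [G [K [K0 mG G0 IG] hG]] := H psi c lpsi fpsi mD c0 io.
exists K => n; pose cost x := n%:R * (c + e2) + orbit_sum tau G n x + K.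
have cost0 x : 0 <= cost x.
  by rewrite !addr_ge0 ?orbit_sum_ge0// mulr_ge0// addr_ge0// ltW.
have mos : measurable_fun setT (orbit_sum tau G n) by exact: measurable_orbit_sum.
have mcost : measurable_fun setT cost.
  by apply: measurable_funD => //; exact: measurable_funD.
have lnphi := label_name mtau n lphi.
have minfo := measurable_info mu lnphi.
have info0 x := info_ge0 mu lnphi x.
pose ex x := expR (info mu (name tau phi n) x - cost x).
have mex : measurable_fun setT ex.
  by apply: (measurableT_comp (@measurable_expR R)); exact: measurable_funB.
have Icost : (\int[mu]_x (cost x)%:E <= (n%:R * (c + e) + K)%:E)%E.
  pose C := n%:R * (c + e2) + K.
  have C0 : 0 <= C by rewrite addr_ge0// mulr_ge0// addr_ge0// ltW.
  have costE x : (cost x)%:E = (C%:E + (orbit_sum tau G n x)%:E)%E.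
    by rewrite -EFinD; congr EFin; rewrite /cost /C; ring.
  under eq_integral do rewrite costE.
  rewrite ge0_integralD//; last 2 first.
  - by move=> x _; rewrite lee_fin orbit_sum_ge0.
  - exact/measurable_EFinP.
  rewrite integral_cst_prob// probability_setT mulr1 integral_orbit_sum//.
  apply: (@le_trans _ _ (C%:E + n%:R%:E * e2%:E)%E).
    by apply: leeD => //; apply: lee_wpmul2l; rewrite ?lee_fin.
  by rewrite -EFinM -EFinD lee_fin /C /e2; lra.
have : (\int[mu]_x (info mu (name tau phi n) x + 1)%:E <=
        \int[mu]_x (cost x + ex x)%:E)%E.
  apply: ge0_le_integral => //.
  - by move=> x _; rewrite lee_fin addr_ge0.
  - by apply/measurable_EFinP; exact: measurable_funD.
  - by apply/measurable_EFinP; exact: measurable_funD.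
  move=> x _; rewrite lee_fin /ex.
  by have := expR_ge1Dx (info mu (name tau phi n) x - cost x); lra.
under eq_integral do rewrite EFinD.
under [X in (_ <= X)%E]eq_integral do rewrite EFinD.
rewrite ge0_integralD//; last 2 first.
- by move=> x _; rewrite lee_fin.
- exact/measurable_EFinP.
rewrite ge0_integralD//; last 4 first.
- by move=> x _; rewrite lee_fin.
- exact/measurable_EFinP.
- by move=> x _; rewrite lee_fin expR_ge0.
- exact/measurable_EFinP.
rewrite integral_cst_prob// probability_setT mulr1 -/(entropy_upto phi n) => h.
have := le_trans h (leeD Icost (hG n)); rewrite -EFinD.
case: (entropy_upto phi n) => [r| |]; rewrite ?leNye// -?EFinD ?lee_fin//.
by move=> h'; rewrite -(lerD2r 1).
Qed.

Hypothesis ergodic : forall E, measurable E -> tau @^-1` E = E ->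
  (mu E = 0 \/ mu E = 1)%E.

(** The slack [m] makes this property forward invariant: passing from [x] to [tau x] shortens the
    name by one letter, and the resulting loss [c] is absorbed by a larger [m]. *)
Definition eventually_ge (c : R) (x : X) : Prop :=
  exists m, forall n, (m <= n)%N ->
    expR (- (c * n%:R) - m%:R) <= prob mu (name tau phi n) x.

Lemma measurable_eventually_ge c : measurable [set x | eventually_ge c x].
Proof.
rewrite (_ : [set x | _] = \bigcup_m \bigcap_(n in [set n | (m <= n)%N])
  [set x | expR (- (c * n%:R) - m%:R) <= prob mu (name tau phi n) x]); last first.
  by apply/seteqP; split=> x [m h]; exists m.
apply: bigcup_measurable => m _; apply: bigcap_measurable => [|n _].
  by exists m => /=.
exact: (label_preimage [set w | expR (- (c * n%:R) - m%:R) <=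
  fine (mu (name tau phi n @^-1` [set w]))] (label_name mtau n lphi)).
Qed.

Lemma prob_nameS n x :
  prob mu (name tau phi n.+1) x <= prob mu (name tau phi n) (tau x).
Proof.
rewrite /prob -(inv_tau (label_name mtau n lphi _)).
apply: le_fine_prob => [||y /= [_ ->]//].
  by apply: (label_name mtau n.+1 lphi).
rewrite -[X in measurable X]setTI; apply: mtau => //; exact: label_name.
Qed.

Lemma eventually_ge_forward c : 0 <= c ->
  [set x | eventually_ge c x] `<=` tau @^-1` [set x | eventually_ge c x].
Proof.
move=> c0 x [m hm]; exists (m + (Num.truncn c).+1)%N => n mn.
apply: le_trans (prob_nameS n x); apply: le_trans (hm n.+1 _); last by lia.
rewrite ler_expR -natr1 natrD; have := truncnS_gt c; lra.
Qed.

(** Markov and Borel-Cantelli bound [info - cost] for all large [n]. The errors in [cost] are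
    controlled for all [n] at once by the maximal inequality, but only off a set of measure at most
    [1 / 2]. The conclusion thus holds with positive probability, and the 0-1 law does the rest. *)
Lemma upper_bound (e : R) : 0 < e ->
  exists2 de : R, 0 < de & forall (psi : X -> I) (c : R), label psi -> finite_range psi ->
    (mu [set x | phi x != psi x] <= de%:E)%E -> 0 <= c ->
    {ae mu, forall x, often mu tau psi c x} ->
  {ae mu, forall x, eventually_ge (c + e) x}.
Proof.
(* One quarter of [e] goes to the coding and one to Borel-Cantelli. Two go to the errors: a
   threshold of twice the bound on their mean gives the exceptional measure [1 / 2]. *)
move=> e0; pose e4 := e / 4; have e40 : 0 < e4 by rewrite divr_gt0.
have [de de0 H] := core_coding mtau inv_tau lphi Hphi e40.
exists de => // psi c lpsi fpsi mD c0 io.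
have [G [K [K0 mG G0 IG] hG]] := H psi c lpsi fpsi mD c0 io.
pose cost n x := n%:R * (c + e4) + orbit_sum tau G n x + K.
have lnphi n := label_name mtau n lphi.
pose ex n x := expR (info mu (name tau phi n) x - cost n x).
have mex n : measurable_fun setT (ex n).
  apply: (measurableT_comp (@measurable_expR R)); apply: measurable_funB.
    exact: measurable_info.
  apply: measurable_funD => //; apply: measurable_funD => //.
  exact: measurable_orbit_sum.
pose F n := [set x | expR (e4 * n%:R) <= ex n x].
have mF n : measurable (F n).
  rewrite (_ : F n = setT `&` ex n @^-1` `[expR (e4 * n%:R), +oo[).
    exact: mex.
  by rewrite setTI; apply/seteqP; split=> x /=; rewrite in_itv /= andbT.
pose q := expR (- e4).
have q01 : 0 <= q < 1 by rewrite expR_ge0 expR_lt1 oppr_lt0.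
have muF n : (mu (F n) <= (q ^+ n)%:E)%E.
  have qn : q ^+ n = (expR (e4 * n%:R))^-1.
    by rewrite /q expRN exprVn; congr (_^-1); rewrite mulrC expRM_natl.
  have pn := expR_gt0 (e4 * n%:R).
  rewrite qn -(fine_probE mu (mF n)) lee_fin -[leRHS]mul1r ler_pdivlMr// mulrC.
  rewrite -lee_fin; apply: le_trans (hG n); rewrite -(integral_cst_prob mu _ (mF n)).
  apply: le_trans (ge0_subset_integral mu (mF n) measurableT (B := setT)
    (f := fun x => (ex n x)%:E) _ _ _) => //.
  - apply: ge0_le_integral => //.
    + by apply/measurable_EFinP; apply: measurable_funTS.
  - exact/measurable_EFinP.
  - by move=> x _; rewrite lee_fin expR_ge0.
have BC : mu (lim_sup_set F) = 0%E.
  apply: (@lim_sup_set_cvg0 _ _ _ mu) => //.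
  apply: (@le_lt_trans _ _ ((1 - q)^-1)%:E); last by rewrite ltry.
  apply: lime_le; first by apply: is_cvg_nneseries.
  apply: nearW => n; apply: le_trans (lee_sum _ (fun k _ => muF k)) _.
  by rewrite sumEFin lee_fin geometric_sum_le.
pose Bad := \bigcup_k [set x | (0 < k)%N /\ e4 *+ 2 * k%:R <= orbit_sum tau G k x].
have mLS : measurable (lim_sup_set F).
  by apply: bigcapT_measurable => n; apply: bigcup_measurable.
have mBad : measurable Bad.
  apply: bigcup_measurable => k _.
  have [->|k0] := posnP k.
    by rewrite (_ : [set x | _] = set0)//; apply/seteqP; split=> x [].
  rewrite (_ : [set x | _] = setT `&` orbit_sum tau G k @^-1` `[e4 *+ 2 * k%:R, +oo[).
    by apply: measurable_orbit_sum.
  by rewrite setTI; apply/seteqP; split=> x /=; rewrite in_itv /= andbT => -[].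
have muBad : fine (mu Bad) <= 1 / 2.
  have t0 : 0 < e4 *+ 2 by rewrite mulrn_wgt0.
  have := le_trans (maximal_inequality mtau inv_tau mG G0 t0) IG.
  rewrite -/Bad -(fine_probE mu mBad) -EFinM lee_fin mulr2n; nra.
pose Z := [set x | exists n, prob mu (name tau phi n) x <= 0].
have key : ~` (Bad `|` lim_sup_set F `|` Z)
    `<=` [set x | eventually_ge (c + e) x].
  move=> x /= /not_orP[/not_orP[nBad nLS] npos].
  have [N hN] : exists N, forall n, (N <= n)%N -> ~ F n x.
    apply: contrapT => nN; apply: nLS => N _.
    apply: contrapT => nF; apply: nN; exists N => n Nn Fn; apply: nF.
    by exists n.
  exists (maxn (maxn N 1) (Num.truncn K).+1) => n.
  rewrite !geq_max => /andP[/andP[Nn n0] Kn].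
  have pn : 0 < prob mu (name tau phi n) x.
    by rewrite ltNge; apply/negP => p0; apply: npos; exists n.
  have /negP := hN n Nn; rewrite -ltNge ltr_expR => h1.
  have h2 : orbit_sum tau G n x < e4 *+ 2 * n%:R.
    rewrite ltNge; apply/negP => h; apply: nBad; exists n => //.
  rewrite (prob_expR pn) ler_expR.
  have KK : K < (maxn (maxn N 1) (Num.truncn K).+1)%:R.
    by apply: lt_le_trans (truncnS_gt K) _; rewrite ler_nat leq_maxr.
  move: h1 h2 KK; rewrite /cost mulr2n /e4; set S := orbit_sum _ _ _ _.
  set i := info _ _ _; set mm := (maxn _ _)%:R; lra.
have mpos : measurable Z.
  rewrite (_ : Z = \bigcup_n [set x | prob mu (name tau phi n) x <= 0]).
    apply: bigcup_measurable => n _.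
    exact: (label_preimage [set w | fine (mu (name tau phi n @^-1` [set w])) <= 0]).
  by apply/seteqP; split=> x; [move=> [n hn]; exists n|move=> [n _ hn]; exists n].
have pos0 : mu Z = 0%E.
  apply/negligibleP => //.
  have := ae_foralln (fun n => ae_prob_gt0 mu (lnphi n)).
  apply: negligibleS => x [n hn] /= /(_ n); by rewrite ltNge hn.
have ce0 : 0 <= c + e by rewrite addr_ge0// ltW.
have mU := measurable_eventually_ge (c + e).
have [U0|U1] := ergodic_forward mtau inv_tau ergodic mU (eventually_ge_forward ce0).
  exfalso.
  have mA : measurable (Bad `|` lim_sup_set F `|` Z).
    by apply: measurableU => //; exact: measurableU.
  have : mu (~` (Bad `|` lim_sup_set F `|`
      Z)) = 0%E.
    by apply: (@subset_measure0 _ _ _ mu _ _ _ _ key) => //; exact: measurableC.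
  rewrite probability_setC// => h1.
  have h2 : (mu (Bad `|` lim_sup_set F `|` Z) <= mu Bad)%E.
    apply: le_trans (measureU2 mu _ _) _ => //; first exact: measurableU.
    rewrite [X in (_ + X)%E](pos0) adde0.
    apply: le_trans (measureU2 mu _ _) _ => //.
    by rewrite [X in (_ + X)%E](BC) adde0.
  move: h1 h2; rewrite -(fine_probE mu mA) -(fine_probE mu mBad) -EFinB => -[].
  by rewrite lee_fin => h1 h2; lra.
exists (~` [set x | eventually_ge (c + e) x]); split => //.
- exact: measurableC.
- by rewrite probability_setC// U1 subee.
Qed.
End Upper.
End Corollaries.


Section ShannonMcMillanBreiman.
Context d (X : measurableType d) (R : realType).
Variables (mu : probability X R) (tau : X -> X).
Hypothesis mtau : measurable_fun setT tau.
Hypothesis inv_tau : forall E, measurable E -> mu (tau @^-1` E) = mu E.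
Hypothesis ergodic : forall E, measurable E -> tau @^-1` E = E ->
  (mu E = 0 \/ mu E = 1)%E.

Definition entropy_mean (I : countType) (phi : X -> I) (n : nat) : \bar R :=
  ((n%:R^-1)%:E * entropy_upto mu tau phi n)%E.

Lemma full_measure_ae (E : set X) : measurable E -> mu E = 1%E ->
  {ae mu, forall x, E x}.
Proof.
move=> mE E1; exists (~` E); split => //; first exact: measurableC.
by rewrite probability_setC// E1 subee.
Qed.

Lemma ae_full_measure (E : set X) : measurable E -> {ae mu, forall x, E x} ->
  mu E = 1%E.
Proof.
move=> mE aeE; have U0 : mu (~` E) = 0%E.
  by apply/negligibleP => //; exact: measurableC.
move: U0; rewrite probability_setC// -(fine_probE mu mE) -EFinB => -[].
by move=> /eqP; rewrite subr_eq0 => /eqP <-.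
Qed.

Lemma null_measure_ae (E : set X) : measurable E -> mu E = 0%E ->
  {ae mu, forall x, ~ E x}.
Proof. by move=> mE E0; exists E; split => // x /= /contrapT. Qed.

Section OneLabel.
Variables (I : countType) (psi : X -> I).
Hypothesis lpsi : label psi.

(** The forward invariant set [W] weakens [often] at rate [c] by an additive constant; it implies
    [often] at rate [c'] because [(c' - c) * n] outgrows any constant. *)
Lemma often_dichotomy (c c' : R) : 0 <= c < c' ->
  {ae mu, forall x, often mu tau psi c' x} \/
  {ae mu, forall x, ~ often mu tau psi c x}.
Proof.
move=> /andP[c0 cc'].
pose W := [set x | exists m, forall k, exists2 n, (k <= n)%N &
  expR (- (c * n%:R) - m%:R) <= prob mu (name tau psi n) x].
have mW : measurable W.
  rewrite (_ : W = \bigcup_m \bigcap_k \bigcup_(n in [set n | (k <= n)%N])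
    [set x | expR (- (c * n%:R) - m%:R) <= prob mu (name tau psi n) x]).
    apply: bigcup_measurable => m _; apply: bigcapT_measurable => k.
    apply: bigcup_measurable => n _.
    exact: (label_preimage [set w | expR (- (c * n%:R) - m%:R) <=
      fine (mu (name tau psi n @^-1` [set w]))] (label_name mtau n lpsi)).
  apply/seteqP; split=> x.
    by move=> [m h]; exists m => // k _; have [n kn hn] := h k; exists n.
  by move=> [m _ h]; exists m => k; have [n kn hn] := h k Logic.I; exists n.
have fW : W `<=` tau @^-1` W.
  move=> x [m h]; exists (m + (Num.truncn c).+1)%N => k.
  have [[|n] // kn hn] := h k.+1; exists n => //.
  apply: le_trans (prob_nameS mtau inv_tau lpsi n x); apply: le_trans hn.
  rewrite ler_expR -natr1 natrD; have := truncnS_gt c; lra.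
have [W0|W1] := ergodic_forward mtau inv_tau ergodic mW fW.
  right; apply: filterS (null_measure_ae mW W0) => x nW o; apply: nW.
  by exists 0%N => k; have [n kn hn] := o k; exists n; rewrite ?subr0.
left; apply: filterS (full_measure_ae mW W1) => x [m h] k.
have [n kn hn] := h (maxn k (Num.truncn (m%:R / (c' - c))).+1).
move: kn; rewrite geq_max => /andP[kn mn]; exists n => //.
apply: le_trans hn; rewrite ler_expR.
have : m%:R / (c' - c) < n%:R.
  by apply: lt_le_trans (truncnS_gt _) _; rewrite ler_nat.
rewrite ltr_pdivrMr ?subr_gt0// => h'; nra.
Qed.

Lemma entropy_mean_ge0 n : (0 <= entropy_mean psi n)%E.
Proof.
by rewrite mule_ge0 ?lee_fin ?invr_ge0//; exact: entropy_upto_ge0.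
Qed.

Lemma not_often_entropy_ge (b c : R) : 0 <= b < c ->
  {ae mu, forall x, ~ often mu tau psi c x} ->
  \forall n \near \oo, (b%:E <= entropy_mean psi n)%E.
Proof.
move=> /andP[b0 bc] no; have c0 : 0 < c by exact: le_lt_trans bc.
pose F N := \bigcap_(n in [set n | (N <= n)%N])
  [set x | prob mu (name tau psi n) x < expR (- (c * n%:R))].
have mF N : measurable (F N).
  apply: bigcap_measurable => [|n _]; first by exists N => /=.
  exact: (label_preimage [set w | fine (mu (name tau psi n @^-1` [set w])) <
    expR (- (c * n%:R))] (label_name mtau n lpsi)).
have F1 : mu (\bigcup_N F N) = 1%E.
  apply: ae_full_measure; first exact: bigcup_measurable.
  apply: filterS no => x nox; apply: contrapT => nU; apply: nox => k.
  apply: contrapT => nk; apply: nU; exists k => // n /= kn.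
  by rewrite ltNge; apply/negP => h; apply: nk; exists n.
(* Information at least [c * n] on a set of mass [b / c] already gives mean at least [b * n]. *)
have de0 : 0 < 1 - b / c by rewrite subr_gt0 ltr_pdivrMr// mul1r.
have ndF i j : (i <= j)%N -> F i `<=` F j.
  by move=> ij x h n /= jn; apply: h => /=; exact: leq_trans jn.
have [N hN] := measure_exhaust mF ndF F1 de0.
exists (maxn N 1) => // n /=; rewrite geq_max => /andP[Nn n0].
have nR : 0 < n%:R :> R by rewrite ltr0n.
have muF : b / c <= fine (mu (F N)).
  have := hN N (leqnn N); rewrite probability_setC// -(fine_probE mu (mF N)).
  by rewrite -EFinB lee_fin; lra.
suff : ((n%:R * b)%:E <= entropy_upto mu tau psi n)%E.
  move=> h; rewrite /entropy_mean (_ : b = n%:R^-1 * (n%:R * b)).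
    by rewrite EFinM; apply: lee_wpmul2l => //; rewrite lee_fin invr_ge0 ltW.
  by rewrite mulrA mulVf ?mul1r// gt_eqF.
have cn0 : 0 <= c * n%:R by rewrite mulr_ge0// ltW.
apply: (@le_trans _ _ (\int[mu]_x ((c * n%:R) * \1_(F N) x)%:E)%E).
  under eq_integral do rewrite EFinM.
  rewrite ge0_integralZl//; last first.
    exact/measurable_EFinP.
  rewrite integral_indic// setIT -[X in (_ <= _ * X)%E](fine_probE mu (mF N)).
  rewrite -EFinM lee_fin.
  have := ler_wpM2l cn0 muF.
  by rewrite (_ : c * n%:R * (b / c) = n%:R * b)//; field; rewrite gt_eqF.
have lnpsi := label_name mtau n lpsi.
apply: ae_ge0_le_integral => //.
- by move=> x _; rewrite lee_fin mulr_ge0// indicE.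
- by apply/measurable_EFinP; apply: measurable_funM.
- by move=> x _; rewrite lee_fin info_ge0.
- by apply/measurable_EFinP; exact: measurable_info.
apply: filterS (ae_prob_gt0 mu lnpsi) => x px _; rewrite lee_fin indicE.
have [xF|xF] := boolP (x \in F N); last by rewrite mulr0 info_ge0.
rewrite mulr1; move: xF; rewrite inE => /(_ n Nn) /=.
by rewrite (prob_expR px) ltr_expR ltrN2 => /ltW.
Qed.

(** By the dichotomy, failure would make the entropy means eventually exceed some [b > l]. *)
Lemma entropy_lim_often (l : \bar R) (c : R) :
  entropy_mean psi n @[n --> \oo] --> l -> (l < c%:E)%E ->
  {ae mu, forall x, often mu tau psi c x}.
Proof.
move=> cl lc; have l0 : (0 <= l)%E.
  by apply: (lim_ge_near cl); apply: nearW => n; exact: entropy_mean_ge0.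
have [c1 [lc1 c1c]] := ereal_lt_between lc; rewrite lte_fin in c1c.
have [b [lb bc1]] := ereal_lt_between lc1; rewrite lte_fin in bc1.
have b0 : 0 <= b by rewrite -lee_fin ltW// (le_lt_trans l0).
have c10 : 0 <= c1 < c by rewrite c1c andbT (le_trans b0)// ltW.
have [//|no] := often_dichotomy c10; exfalso.
have b0c : 0 <= b < c1 by rewrite b0.
have := lim_ge_near cl (not_often_entropy_ge b0c no).
by rewrite leNgt lb.
Qed.

Lemma finite_range_entropy : finite_range psi ->
  (\int[mu]_x (info mu psi x)%:E < +oo)%E.
Proof.
move=> [s sP].
have [k /andP[k0 k1] hk] :=
  min_positive s (fun a => fine (mu (psi @^-1` [set a]))).
apply: (@le_lt_trans _ _ (\int[mu]_x (- ln k)%:E)%E); last first.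
  by rewrite integral_cst_prob// ltry.
apply: ae_ge0_le_integral => //.
- by move=> x _; rewrite lee_fin info_ge0.
- by apply/measurable_EFinP; exact: measurable_info.
- by move=> x _; rewrite lee_fin oppr_ge0 ln_le0.
apply: filterS (ae_prob_gt0 mu lpsi) => x px _.
by rewrite lee_fin lerN2 ler_ln ?posrE//; exact: hk.
Qed.
End OneLabel.

Lemma entropy_mean_le (I : countType) (phi : X -> I) (c b K : R) :
  c < b -> (forall n, (entropy_upto mu tau phi n <= (n%:R * c + K)%:E)%E) ->
  \forall n \near \oo, (entropy_mean phi n <= b%:E)%E.
Proof.
move=> cb h; exists (Num.truncn (K / (b - c))).+1 => // n /= Kn.
have nR : 0 < n%:R :> R by rewrite ltr0n; exact: leq_trans Kn.
apply: (@le_trans _ _ ((n%:R^-1)%:E * (n%:R * c + K)%:E)%E).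
  by apply: lee_wpmul2l; rewrite ?lee_fin ?invr_ge0// ltW.
rewrite -EFinM lee_fin ler_pdivrMl//.
have : K / (b - c) < n%:R.
  by apply: lt_le_trans (truncnS_gt _) _; rewrite ler_nat.
rewrite ltr_pdivrMr ?subr_gt0// => h1; nra.
Qed.

(** The coding inequality with [phi = psi] takes the place of subadditivity. Given [a < b], the
    dichotomy for [often] at rates in between either bounds the means by [b], through the code, or
    keeps them above [a]. *)
Lemma entropy_mean_cvg (I : countType) (psi : X -> I) :
  label psi -> finite_range psi ->
  exists l : \bar R, entropy_mean psi n @[n --> \oo] --> l.
Proof.
move=> lpsi fpsi; apply: ereal_cvg_dichotomy => a b ab.
have [a0|a0] := ltP a 0.
  right; apply: nearW => n; apply: le_trans (entropy_mean_ge0 lpsi n).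
  by rewrite lee_fin ltW.
pose e := (b - a) / 4; have e0 : 0 < e by rewrite divr_gt0// subr_gt0.
have hae : 0 <= a + e < a + e *+ 2.
  by rewrite addr_ge0// ?(ltW e0)//= mulr2n; lra.
have [ho|no] := often_dichotomy lpsi hae; last first.
  by right; apply: not_often_entropy_ge no => //; rewrite a0 ltrDl.
left; have [de de0 H] :=
  entropy_upto_le mtau inv_tau lpsi (finite_range_entropy lpsi fpsi) e0.
case: (H psi (a + e *+ 2) lpsi fpsi _ _ ho) => [||K hK].
- rewrite (_ : [set x | _] = set0) ?measure0 ?lee_fin ?ltW//.
  by apply/seteqP; split=> x //=; rewrite eqxx.
- by case/andP: hae => h1 h2; rewrite (le_trans h1)// ltW.
by apply: entropy_mean_le hK; rewrite /e mulr2n; lra.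
Qed.

(** * A countable labelling compared with finite ones *)

Section Generator.
Variables (J : countType) (alpha : X -> J).
Hypothesis lalpha : label alpha.

(** An [alpha]-name of length [n] determines the [psi]-name of length [n - k]; for large [n] the
    loss of [k] letters is covered by [c' - c]. *)
Lemma often_determined (I : countType) (psi : X -> I) (k : nat) (c c' : R) x :
  label psi -> 0 <= c < c' ->
  (forall y z, name tau alpha k y = name tau alpha k z -> psi y = psi z) ->
  often mu tau alpha c x -> often mu tau psi c' x.
Proof.
move=> lpsi /andP[c0 cc'] det o l.
have [n] := o (l + k + (Num.truncn (c' * k%:R / (c' - c))).+1)%N.
move=> ln hn; exists (n - k)%N; first by lia.
have kn : (k <= n)%N by lia.
apply: (@le_trans _ _ (prob mu (name tau alpha n) x)).
  apply: le_trans hn; rewrite ler_expR lerN2 natrB//.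
  have : c' * k%:R / (c' - c) < n%:R.
    by apply: lt_le_trans (truncnS_gt _) _; rewrite ler_nat; exact: leq_trans (leq_addl _ _) ln.
  by rewrite ltr_pdivrMr ?subr_gt0// => h1; nra.
apply: prob_refine; try exact: label_name.
move=> y /eq_nameP e; apply/eq_nameP => i ik; apply: det.
by apply/eq_nameP => j jk; rewrite -!iterD; apply: e; lia.
Qed.

(** If [alpha] had large cells often, so would every [psi] read from finitely many of its letters.
    With such a [psi] close to [phi], the code would bring the entropy of [phi] to at most
    [c + 3 * e < b < l]. *)
Lemma lower_bound (I : countType) (phi : X -> I) (l : \bar R) (c : R) :
  label phi -> finite_range phi ->
  (forall de : R, 0 < de -> exists psi : X -> I, exists k,
    [/\ label psi, finite_range psi,
     forall y z, name tau alpha k y = name tau alpha k z -> psi y = psi z &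
     (mu [set x | phi x != psi x] <= de%:E)%E]) ->
  entropy_mean phi n @[n --> \oo] --> l -> 0 <= c -> (c%:E < l)%E ->
  {ae mu, forall x, ~ often mu tau alpha c x}.
Proof.
move=> lphi fphi approx cl c0 ccl.
have [b [cb bl]] := ereal_lt_between ccl; rewrite lte_fin in cb.
pose e := (b - c) / 4; have e0 : 0 < e by rewrite divr_gt0// subr_gt0.
have c1 : 0 <= c < c + e by rewrite c0 ltrDl.
have [ho|//] := often_dichotomy lalpha c1; exfalso.
have [de de0 H] := entropy_upto_le mtau inv_tau lphi (finite_range_entropy lphi fphi) e0.
have [psi [k [lpsi fpsi det mD]]] := approx de de0.
have c2 : 0 <= c + e < c + e + e by rewrite addr_ge0// ?(ltW e0)// ltrDl.
have c30 : 0 <= c + e + e by rewrite !addr_ge0// ltW.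
have o2 : {ae mu, forall x, often mu tau psi (c + e + e) x}.
  by apply: filterS ho => x; exact: (often_determined lpsi c2 det).
have [K hK] := H psi (c + e + e) lpsi fpsi mD c30 o2.
have : (l <= b%:E)%E.
  by apply: (lim_le_near cl); apply: entropy_mean_le hK; rewrite /e; lra.
by rewrite leNgt bl.
Qed.

(* The digits outside [s] are merged with a digit [a0] of [s], and not with one
   another, so that no cell of the resulting partition is empty. *)
Definition lump (s : seq J) (a0 : J) (x : X) : J :=
  if alpha x \in s then alpha x else a0.

Lemma label_lump s a0 : label (lump s a0).
Proof. exact: (label_comp (fun a => if a \in s then a else a0) lalpha). Qed.

Lemma finite_range_lump s a0 : a0 \in s -> finite_range (lump s a0).
Proof. by move=> a0s; exists s => x; rewrite /lump; case: ifPn. Qed.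

(** Finite entropy of [alpha] fixes the tolerated disagreement first; then [s] is taken large enough
    for the digits outside it to be that rare. *)
Lemma upper_bound_lump (a0 : J) (c c' : R) :
  (\int[mu]_x (info mu alpha x)%:E < +oo)%E -> 0 <= c < c' ->
  (forall s, uniq s -> a0 \in s -> exists2 l : \bar R,
    entropy_mean (lump s a0) n @[n --> \oo] --> l & (l < c%:E)%E) ->
  {ae mu, forall x, eventually_ge mu tau alpha c' x}.
Proof.
move=> Halpha /andP[c0 cc'] hl; have e0 : 0 < c' - c by rewrite subr_gt0.
have [de de0 H] := upper_bound mtau inv_tau lalpha Halpha ergodic e0.
pose F n := [set x | (pickle (alpha x) <= n)%N].
have mF n : measurable (F n).
  exact: (label_preimage [set a | (pickle a <= n)%N]).
have F1 : mu (\bigcup_n F n) = 1%E.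
  rewrite (_ : \bigcup_n F n = setT) ?probability_setT//.
  by apply/seteqP; split=> x // _; exists (pickle (alpha x)) => //=; exact: leqnn.
have ndF i j : (i <= j)%N -> F i `<=` F j.
  by move=> ij x /leq_trans; exact.
have [N /(_ N (leqnn N)) hN] := measure_exhaust mF ndF F1 de0.
pose s := undup (a0 :: pmap unpickle (iota 0 N.+1)).
have us : uniq s by exact: undup_uniq.
have a0s : a0 \in s by rewrite mem_undup inE eqxx.
have sF x : F N x -> alpha x \in s.
  move=> xF; rewrite mem_undup inE mem_pmap; apply/orP; right.
  by apply/mapP; exists (pickle (alpha x)); rewrite ?pickleK// mem_iota add0n.
have [l cl lc] := hl s us a0s.
have -> : c' = c + (c' - c) by rewrite addrC subrK.
apply: (H (lump s a0)) => //.
- exact: label_lump.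
- exact: finite_range_lump.
- apply: le_trans hN; apply: le_measure; rewrite ?inE.
  + exact: (label_preimage [set p : J * J | p.1 != p.2] (label_pair lalpha (label_lump s a0))).
  + exact: measurableC.
  by move=> x /= h xF; move: h; rewrite /lump sF// eqxx.
- exact: (entropy_lim_often (label_lump s a0) cl).
Qed.
End Generator.
End ShannonMcMillanBreiman.


(** * Fibred systems *)

Section LabelEntropy.
Context d (X : measurableType d) (R : realType).
Variable mu : probability X R.

Lemma integral_info (J : countType) (g : X -> J) : label g ->
  (\int[mu]_x (info mu g x)%:E = \esum_(j in [set: J])
    (- (fine (mu (g @^-1` [set j])) * ln (fine (mu (g @^-1` [set j])))))%:E)%E.
Proof.
move=> lg; rewrite (integral_label mu lg measurableT); last first.
- by move=> x _; rewrite lee_fin info_ge0.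
- by apply/measurable_EFinP; exact: measurable_info.
apply: eq_esum => j _; rewrite setTI.
rewrite (eq_integral (fun=> (- ln (fine (mu (g @^-1` [set j]))))%:E)); last first.
  by move=> x; rewrite inE /info /prob /= => ->.
by rewrite integral_cst_prob// mulNr mulrC.
Qed.

Lemma eq_info (I J : Type) (f : X -> I) (g : X -> J) x :
  (forall y, f y = f x <-> g y = g x) -> info mu f x = info mu g x.
Proof.
move=> fg; congr (- ln (fine (mu _))).
by apply/seteqP; split=> y /=; rewrite fg.
Qed.

Lemma eq_entropy_upto (tau : X -> X) (I J : countType) (f : X -> I) (g : X -> J) n :
  (forall x y, f x = f y <-> g x = g y) ->
  entropy_upto mu tau f n = entropy_upto mu tau g n.
Proof.
move=> fg; apply: eq_integral => x _; congr EFin; apply: eq_info => y.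
by split=> /eq_nameP e; apply/eq_nameP => i /e; rewrite fg.
Qed.
End LabelEntropy.

Section FibredSystem.
Variables (R : realType) (B : set R) (T : R -> R) (D : countType) (k : R -> D).
Variable mu : probability (measurableTypeR R) R.
Hypothesis hT : number_theoretic B T k mu.
Let X : measurableType _ := measurableTypeR R.

Let fT := nt_fibred hT.

Lemma fibred_measurable : measurable (B : set X).
Proof. exact: is_interval_measurable (fibred_interval fT). Qed.

Lemma digit_measurable i : measurable (digit_set B k i : set X).
Proof.
by have mi := is_interval_measurable (fibred_digit_interval (i := i) fT); exact: mi.
Qed.

Lemma fibred_nonempty : exists x, B x.
Proof.
apply: contrapT => nB; have := nt_mass hT.
rewrite (_ : B = set0) ?measure0; last first.
  by apply/seteqP; split=> x // Bx; case: nB; exists x.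
by move=> /eqP; rewrite eq_sym onee_eq0.
Qed.

Definition base_point : R := projT1 (cid fibred_nonempty).

Lemma base_pointP : B base_point. Proof. exact: (projT2 (cid fibred_nonempty)). Qed.

Definition retract (x : R) : R := if x \in B then x else base_point.

Lemma retractP x : B (retract x).
Proof. by rewrite /retract; case: ifPn => [/set_mem//|_]; exact: base_pointP. Qed.

Lemma retract_id x : B x -> retract x = x.
Proof. by move=> Bx; rewrite /retract mem_set. Qed.

(* [T] and [k] are only meaningful on [B]: they are made total by sending the
   complement of [B], a null set, to a point of [B]. *)
Definition total_map (x : X) : X := T (retract x).

Definition total_digit (x : X) : D := k (retract x).

Lemma total_mapE x : B x -> total_map x = T x.
Proof. by move=> Bx; rewrite /total_map retract_id. Qed.

Lemma fibred_map x : B x -> B (T x).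
Proof. by move=> Bx; rewrite -(fibred_surjective fT); exists x. Qed.

Lemma iter_fibred_map i x : B x -> B (iter i T x).
Proof. by move=> Bx; elim: i => //= i; exact: fibred_map. Qed.

Lemma iter_total_map i x : B x -> iter i total_map x = iter i T x.
Proof.
by move=> Bx; elim: i => //= i ->; rewrite total_mapE//; exact: iter_fibred_map.
Qed.

Lemma preimage_retract (E : set R) : retract @^-1` E =
  (B `&` E) `|` (~` B `&` [set _ | E base_point]).
Proof.
apply/seteqP; split=> x /=; rewrite /retract.
  by case: ifPn => [/set_mem|/negP]; [left|rewrite inE; right].
by move=> [[Bx Ex]|[Bx Eb]]; [rewrite mem_set|rewrite memNset].
Qed.

Lemma measurable_preimage_retract (E : set R) : measurable (B `&` E : set X) ->
  measurable (retract @^-1` E : set X).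
Proof.
move=> mE; rewrite preimage_retract; apply: measurableU => //.
have [Eb|Eb] := pselect (E base_point).
  rewrite (_ : [set _ | _] = setT) ?setIT; last by apply/seteqP; split.
  exact: measurableC fibred_measurable.
by rewrite (_ : [set _ | _] = set0) ?setI0//; apply/seteqP; split=> x.
Qed.

Lemma measurable_total_map : measurable_fun setT total_map.
Proof.
move=> _ Y mY; rewrite setTI -[_ @^-1` _]/(retract @^-1` (T @^-1` Y)).
apply: measurable_preimage_retract.
rewrite (_ : B `&` T @^-1` Y = \bigcup_i (digit_set B k i `&` T @^-1` Y)).
  apply: countable_bigcupT_measurable => [|i]; first exact: countableP.
  have mi := digit_measurable i.
  have cT := @fibred_continuous _ _ _ _ _ fT i.
  by have h := subspace_continuous_measurable_fun mi cT mi mY; exact: h.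
apply/seteqP; split=> x; first by move=> [Bx Yx]; exists (k x).
by move=> [i _ [[Bx _] Yx]].
Qed.

Lemma label_total_digit : label total_digit.
Proof.
move=> i.
exact: (measurable_preimage_retract (E := k @^-1` [set i]) (digit_measurable i)).
Qed.

Lemma measure_setC_fibred : mu (~` B) = 0%E.
Proof.
by rewrite probability_setC ?(nt_mass hT) ?subee//; exact: fibred_measurable.
Qed.

Lemma measure_setI_fibred (E : set X) : measurable E -> mu (B `&` E) = mu E.
Proof.
move=> mE; have mB := fibred_measurable.
rewrite -[E in RHS]setIT -(setUv B) setIUr measureU//; last 3 first.
- exact: measurableI.
- by apply: measurableI => //; exact: measurableC.
- by rewrite setIACA setICr setI0.
rewrite [X in (_ + X)%E](_ : _ = 0%E) ?adde0 ?(setIC B)//.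
apply: (@subset_measure0 _ _ _ mu _ (~` B)) => //.
- by apply: measurableI => //; exact: measurableC.
- exact: measurableC.
- exact: measure_setC_fibred.
Qed.

Lemma total_map_invariant (E : set X) : measurable E ->
  mu (total_map @^-1` E) = mu E.
Proof.
move=> mE; have mB := fibred_measurable.
have mTE : measurable (total_map @^-1` E).
  by rewrite -[X in measurable X]setTI; exact: measurable_total_map.
rewrite -(measure_setI_fibred mTE) -[RHS](measure_setI_fibred mE).
rewrite -(nt_invariant hT (E := B `&` E)); [|exact: measurableI|by move=> x []].
congr (mu _); apply/seteqP; split=> x /= [Bx].
  by rewrite total_mapE// => Ex; split=> //; split=> //; exact: fibred_map.
by move=> [_ Ex]; rewrite total_mapE.
Qed.

Lemma total_map_ergodic (E : set X) : measurable E ->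
  total_map @^-1` E = E -> (mu E = 0 \/ mu E = 1)%E.
Proof.
move=> mE EE; rewrite -(measure_setI_fibred mE).
apply: (nt_ergodic hT (E := B `&` E)).
- by apply: measurableI => //; exact: fibred_measurable.
- by move=> x [].
apply/seteqP; split=> x /= [Bx].
  by move=> [_ Ex]; split=> //; rewrite -EE /= total_mapE.
move=> Ex; split=> //; split; first exact: fibred_map.
by move: Ex; rewrite -{1}EE /= total_mapE.
Qed.

Lemma cylinder_atE n x : B x -> cylinder_at B T k n x =
  B `&` [set y | name total_map total_digit n y = name total_map total_digit n x].
Proof.
move=> Bx; apply/seteqP; split=> y /= [By h]; split=> //.
  apply/eq_nameP => i ni; have := h (Ordinal ni); rewrite tnth_mktuple /= => -[_ /= e].
  by rewrite /total_digit !iter_total_map// !retract_id//; exact: iter_fibred_map.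
move=> i; rewrite tnth_mktuple; split; first exact: iter_fibred_map.
move/eq_nameP: h => /(_ i (ltn_ord i)); rewrite /total_digit !iter_total_map//.
by rewrite !retract_id//; exact: iter_fibred_map.
Qed.

Lemma measurable_cylinder_at n x : B x -> measurable (cylinder_at B T k n x : set X).
Proof.
move=> Bx; rewrite cylinder_atE//; apply: measurableI; first exact: fibred_measurable.
exact: (label_name measurable_total_map n label_total_digit).
Qed.

Lemma measure_cylinder_at n x : B x ->
  fine (mu (cylinder_at B T k n x)) = prob mu (name total_map total_digit n) x.
Proof.
move=> Bx; rewrite cylinder_atE// measure_setI_fibred//.
exact: (label_name measurable_total_map n label_total_digit).
Qed.

Lemma partition_entropy_digit :
  partition_entropy mu (digit_set B k) = (\int[mu]_x (info mu total_digit x)%:E)%E.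
Proof.
rewrite integral_info; last exact: label_total_digit.
apply: eq_esum => i _; congr ((- (fine _ * ln (fine _)))%:E);
  rewrite -[RHS]measure_setI_fibred; try exact: label_total_digit;
  by congr (mu _); apply/seteqP; split=> x [Bx h]; split=> //;
    move: h; rewrite /= /total_digit retract_id.
Qed.

Section FinitePartition.
Variables (p : nat) (A : 'I_p -> set X).
Hypotheses (mA : forall i, measurable (A i)) (pA : partition setT A B).

Lemma partition_index x : exists i, A i (retract x).
Proof.
by have [cA _ _] := pA; have := retractP x; rewrite -cA => -[i _ Ai]; exists i.
Qed.

Definition index_of (x : X) : 'I_p := projT1 (cid (partition_index x)).

Lemma index_ofP x i : index_of x = i <-> A i (retract x).
Proof.
have Ax := projT2 (cid (partition_index x)); split=> [<-//|Ai].
have [_ tA _] := pA; apply: (tA _ _ I I); by exists (retract x).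
Qed.

Lemma label_index_of : label index_of.
Proof.
move=> i; rewrite (_ : _ @^-1` _ = retract @^-1` A i); last first.
  by apply/seteqP; split=> x /=; rewrite index_ofP.
by apply: measurable_preimage_retract; apply: measurableI => //; exact: fibred_measurable.
Qed.

Lemma partition_entropy_cylinder n :
  partition_entropy mu (fun w : n.-tuple 'I_p => cylinder B T A w) =
  entropy_upto mu total_map index_of n.
Proof.
pose g x := [tuple index_of (iter i total_map x) | i < n].
have gname x : tval (g x) = name total_map index_of n x.
  apply: (@eq_from_nth _ (index_of x)); rewrite ?size_tuple ?size_name// => i ni.
  rewrite -[i]/(nat_of_ord (Ordinal ni)) -tnth_nth tnth_mktuple /=.
  by rewrite nth_name.
have lg : label g.
  move=> w; rewrite (_ : _ @^-1` _ = name total_map index_of n @^-1` [set tval w]).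
    exact: (label_name measurable_total_map n label_index_of).
  apply/seteqP; split=> x /=; rewrite -gname; first by move=> ->.
  by move=> e; exact: val_inj.
transitivity (\int[mu]_x (info mu g x)%:E)%E; last first.
  apply: eq_integral => x _; congr EFin; apply: eq_info => y.
  by rewrite -!gname; split=> [->//|e]; exact: val_inj.
rewrite integral_info//; apply: eq_esum => w _.
suff -> : mu (cylinder B T A w) = mu (g @^-1` [set w]) by [].
rewrite -[RHS]measure_setI_fibred; last exact: lg.
congr (mu _); apply/seteqP; split=> x /= [Bx h]; split=> //.
  apply: eq_from_tnth => i; rewrite tnth_mktuple; apply/index_ofP.
  by rewrite iter_total_map// retract_id//; exact: iter_fibred_map.
move=> i; move: h => /(congr1 (fun t => tnth t i)); rewrite tnth_mktuple.
by move=> /index_ofP; rewrite iter_total_map// retract_id//; exact: iter_fibred_map.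
Qed.

(** [entropy_wrt] is written with [limn], which is meaningful only for a convergent sequence; the
    convergence comes from [entropy_mean_cvg]. *)
Lemma entropy_wrt_lim :
  entropy_mean mu total_map index_of n @[n --> \oo] --> entropy_wrt B T mu A.
Proof.
have frange : finite_range index_of.
  by exists (enum 'I_p) => x; rewrite mem_enum.
have [l cl] := entropy_mean_cvg measurable_total_map total_map_invariant
  total_map_ergodic label_index_of frange.
have -> : entropy_wrt B T mu A = l.
  rewrite /entropy_wrt; apply: cvg_lim => //; apply: cvg_trans cl.
  by apply: near_eq_cvg; apply: nearW => n; rewrite /entropy_mean partition_entropy_cylinder.
exact: cl.
Qed.
End FinitePartition.

End FibredSystem.


(** * Approximation of sets and finite labellings by cylinders *)

Section Approximation.
Variables (R : realType) (B : set R) (T : R -> R) (D : countType) (k : R -> D).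
Variable mu : probability (measurableTypeR R) R.
Hypothesis hT : number_theoretic B T k mu.
Let X : measurableType _ := measurableTypeR R.
Let tau : X -> X := total_map hT.
Let alpha : X -> D := total_digit hT.
Let mtau : measurable_fun setT tau := measurable_total_map hT.
Let lalpha : label alpha := label_total_digit hT.

Definition determined (n : nat) (U : set X) : Prop :=
  forall y z, name tau alpha n y = name tau alpha n z -> U y -> U z.

Lemma determined_le m n U : (m <= n)%N -> determined m U -> determined n U.
Proof. by move=> mn dU y z e; apply: dU; exact: eq_name_le e. Qed.

Lemma determined_measurable n U : determined n U -> measurable U.
Proof.
move=> dU; rewrite (_ : U = name tau alpha n @^-1` (name tau alpha n @` U)).
  by apply: label_preimage; exact: label_name.
by apply/seteqP; split=> x /=; [exists x|move=> [y Uy e]; exact: dU e Uy].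
Qed.

Lemma determinedC n U : determined n U -> determined n (~` U).
Proof. by move=> dU y z e nU Uz; apply: nU; exact: dU (esym e) Uz. Qed.

Lemma determinedU n U V : determined n U -> determined n V -> determined n (U `|` V).
Proof. by move=> dU dV y z e [/(dU _ _ e)|/(dV _ _ e)]; [left|right]. Qed.

Definition symdiff (E F : set X) : set X := (E `\` F) `|` (F `\` E).

Lemma measurable_symdiff E F : measurable E -> measurable F ->
  measurable (symdiff E F).
Proof. by move=> mE mF; apply: measurableU; exact: measurableD. Qed.

Lemma symdiff_triangle E F G : symdiff E G `<=` symdiff E F `|` symdiff F G.
Proof.
move=> x [[Ex nG]|[Gx nE]]; have [Fx|nF] := pselect (F x).
- by right; left.
- by left; left.
- by left; right.
- by right; right.
Qed.

Definition approximable (E : set X) : Prop := measurable E /\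
  forall e : R, 0 < e -> exists n U, determined n U /\
    (mu (symdiff E U) <= e%:E)%E.

Lemma measure_le_cover (E F G : set X) (a b : R) :
  measurable E -> measurable F -> measurable G -> E `<=` F `|` G ->
  (mu F <= a%:E)%E -> (mu G <= b%:E)%E -> (mu E <= (a + b)%:E)%E.
Proof.
move=> mE mF mG EFG Fa Gb.
apply: (@le_trans _ _ (mu (F `|` G))).
  by apply: le_measure; rewrite ?inE//; exact: measurableU.
by apply: le_trans (measureU2 mu mF mG) _; rewrite EFinD; apply: leeD.
Qed.

(** Being approximable is a closed condition for the distance [mu (symdiff E F)]; this reduces
    countable unions to finite ones and makes null sets harmless. *)
Lemma approximable_limit (E : set X) : measurable E ->
  (forall e : R, 0 < e -> exists2 F, approximable F & (mu (symdiff E F) <= e%:E)%E) ->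
  approximable E.
Proof.
move=> mE h; split=> // e e0.
have e2 : 0 < e / 2 by rewrite divr_gt0.
have [F [mF aF] EF] := h _ e2; have [n [U [dU FU]]] := aF _ e2.
have mU := determined_measurable dU.
exists n, U; split=> //; rewrite [e](splitr e).
by apply: measure_le_cover (@symdiff_triangle E F U) EF FU; exact: measurable_symdiff.
Qed.

Lemma approximable_setU (E F : set X) :
  approximable E -> approximable F -> approximable (E `|` F).
Proof.
move=> [mE aE] [mF aF]; split=> [|e e0]; first exact: measurableU.
have e2 : 0 < e / 2 by rewrite divr_gt0.
have [m [U [dU EU]]] := aE _ e2; have [n [V [dV FV]]] := aF _ e2.
have mU := determined_measurable dU; have mV := determined_measurable dV.
exists (maxn m n), (U `|` V); split.
  by apply: determinedU; [apply: determined_le dU|apply: determined_le dV]; lia.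
rewrite [e](splitr e); apply: measure_le_cover EU FV; try exact: measurable_symdiff.
  by apply: measurable_symdiff; exact: measurableU.
by move=> x; rewrite /symdiff /=; tauto.
Qed.

Lemma approximable_null (E F : set X) : measurable E -> approximable F ->
  mu (symdiff E F) = 0%E -> approximable E.
Proof.
move=> mE aF EF0; apply: approximable_limit => // e e0; exists F => //.
by rewrite EF0 lee_fin ltW.
Qed.

Lemma approximable0 : approximable set0.
Proof.
split=> // e e0; exists 0%N, set0; split=> //.
by rewrite /symdiff setD0 setU0 measure0 lee_fin ltW.
Qed.

Lemma approximableD (E : set X) : approximable E -> approximable (B `\` E).
Proof.
move=> [mE aE]; have mB := fibred_measurable hT.
split=> [|e e0]; first exact: measurableD.
have [n [U [dU EU]]] := aE _ e0; have mU := determined_measurable dU.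
exists n, (~` U); split; first exact: determinedC.
rewrite -[e]addr0; apply: (measure_le_cover (F := symdiff E U) (G := ~` B)) => //.
- by apply: measurable_symdiff; [exact: measurableD|exact: measurableC].
- exact: measurable_symdiff.
- exact: measurableC.
- by move=> x; rewrite /symdiff /=; have := EM (B x); have := EM (U x); have := EM (E x); tauto.
- by rewrite (measure_setC_fibred hT).
Qed.

Lemma approximable_bigcup (F : nat -> set X) :
  (forall n, approximable (F n)) -> approximable (\bigcup_n F n).
Proof.
move=> aF; have mF n : measurable (F n) by have [] := aF n.
have mU : measurable (\bigcup_n F n) by exact: bigcup_measurable.
pose V n := \big[setU/set0]_(i < n) F i.
have aV n : approximable (V n).
  rewrite /V; elim: n => [|n IH]; first by rewrite big_ord0; exact: approximable0.
  by rewrite big_ord_recr /=; exact: approximable_setU.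
have mV n : measurable (V n) by have [] := aV n.
have VU n : V n `<=` \bigcup_n F n.
  by rewrite /V; exact: bigsetU_bigcup.
apply: approximable_limit => // e e0.
(* The complement of the union is added so that the sets [W n] exhaust the whole space; the
   complement of [W n] is what [V n] misses of the union. *)
pose W n := V n `|` ~` \bigcup_n F n.
have mW n : measurable (W n) by apply: measurableU => //; exact: measurableC.
have W1 : mu (\bigcup_n W n) = 1%E.
  rewrite (_ : \bigcup_n W n = setT) ?probability_setT//.
  apply/seteqP; split=> x // _; have [[n _ Fx]|nU] := pselect ((\bigcup_n F n) x).
    by exists n.+1 => //; left; rewrite /V big_ord_recr /=; right.
  by exists 0%N => //; right => -[n _ Fx]; apply: nU; exists n.
have ndW i j : (i <= j)%N -> W i `<=` W j.
  by move=> ij x [Vx|nU]; [left; apply: (subset_bigsetU ij)|right].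
have [n /(_ n (leqnn n)) hn] := measure_exhaust mW ndW W1 e0.
exists (V n) => //; apply: le_trans hn; apply: le_measure; rewrite ?inE.
- exact: measurable_symdiff.
- exact: (measurableC (mW n)).
move=> x [[Ux nV]|[Vx nU]]; first by case.
by case: nU; exact: VU Vx.
Qed.

Lemma approximable_cylinder (C : set X) :
  (exists n, is_cylinder B T k n C) -> approximable C.
Proof.
move=> [n [w ->]].
have e : cylinder B T (digit_set B k) w =
    B `&` [set y | name tau alpha n y = tval w].
  apply/seteqP; split=> y /= [By h]; split=> //.
    apply: (@eq_from_nth _ (alpha y)); rewrite ?size_tuple ?size_name// => i ni.
    rewrite nth_name//; have := h (Ordinal ni); rewrite (tnth_nth (alpha y)) /=.
    move=> [_ /= <-]; rewrite /alpha /total_digit /tau iter_total_map//.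
    by rewrite retract_id//; exact: (iter_fibred_map hT).
  move=> i; split; first exact: (iter_fibred_map hT).
  rewrite /= (tnth_nth (alpha y)) -h nth_name// /alpha /total_digit.
  by rewrite /tau iter_total_map// retract_id//; exact: (iter_fibred_map hT).
have mB := fibred_measurable hT.
have mN : measurable [set y | name tau alpha n y = tval w] by exact: label_name.
rewrite e; split=> [|e' e0]; first exact: measurableI.
exists n, [set y | name tau alpha n y = tval w]; split.
  by move=> y z /= -> .
rewrite -[e']addr0; apply: (measure_le_cover (F := set0) (G := ~` B)) => //.
- by apply: measurable_symdiff => //; exact: measurableI.
- exact: measurableC.
- by move=> x; rewrite /symdiff /=; have := EM (B x); tauto.
- by rewrite measure0 lee_fin ltW.
- by rewrite (measure_setC_fibred hT).
Qed.

(** The approximable sets contain the cylinders and are stable under the operations of a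
    sigma-algebra on [B]. [generating] reaches [E] from there up to a Lebesgue null set, which is
    null for [mu] by equivalence. *)
Lemma approximable_measurable (E : set X) : measurable E -> E `<=` B ->
  approximable E.
Proof.
move=> mE EB; have mB := fibred_measurable hT.
have [G GG lEG] := fibred_generating (nt_fibred hT) mE EB.
have aG : approximable G.
  apply: (smallest_sub _ _ GG) => [|C]; last exact: approximable_cylinder.
  split; [exact: approximable0|exact: approximableD|exact: approximable_bigcup].
have mG : measurable G by case: aG.
have GB : G `<=` B.
  apply: (smallest_sub (X := [set G | G `<=` B]) _ _ GG) => [|C [n [w ->]] x []//].
  by split=> // [A AB x []//|F FB x [n _ /FB]].
apply: approximable_null aG _ => //.
have [c1 [c2 [c10 c12 hc]]] := nt_equivalent hT.
have [||_ h] := hc (symdiff E G); first exact: measurable_symdiff.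
  by move=> x [[/EB]|[/GB]].
apply/eqP; rewrite eq_le measure_ge0 andbT; apply: le_trans h _.
by rewrite lEG mule0.
Qed.

(** Each of the [p] cells is approximated within [e / p], and [psi] picks an index whose approximant
    contains the point, or [i0] if there is none. A point of [B] outside all the errors lies in
    exactly one approximant, the right one. *)
Lemma approximable_label (p : nat) (f : X -> 'I_p) (e : R) : label f -> 0 < e ->
  exists psi : X -> 'I_p, exists n,
    [/\ label psi, finite_range psi,
     forall y z, name tau alpha n y = name tau alpha n z -> psi y = psi z &
     (mu [set x | f x != psi x] <= e%:E)%E].
Proof.
move=> lf e0; have mB := fibred_measurable hT.
have p0 : (0 < p)%N by case: (f 0) => i; exact: leq_ltn_trans.
pose i0 := Ordinal p0; pose ep := e / p%:R.
have ep0 : 0 < ep by rewrite divr_gt0// ltr0n.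
have h i : exists nU : nat * set X, determined nU.1 nU.2 /\
    (mu (symdiff (B `&` f @^-1` [set i]) nU.2) <= ep%:E)%E.
  have [||_ /(_ _ ep0)] := @approximable_measurable (B `&` f @^-1` [set i]).
  - exact: measurableI.
  - by move=> x [].
  by move=> [n [U [dU hU]]]; exists (n, U).
pose nU i := projT1 (cid (h i)); pose U i := (nU i).2.
pose n := (\max_(i < p) (nU i).1)%N.
have dU i : determined n (U i).
  have [di _] := projT2 (cid (h i)); apply: determined_le di.
  exact: (leq_bigmax (F := fun i => (nU i).1)).
have mU i : measurable (U i) by exact: determined_measurable (dU i).
pose psi y := odflt i0 [pick i | `[< U i y >]].
have det y z : name tau alpha n y = name tau alpha n z -> psi y = psi z.
  move=> e'; rewrite /psi; congr odflt; apply: eq_pick => i.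
  by apply/asboolP/asboolP; [exact: dU|apply: dU; exact: esym].
have lpsi : label psi.
  move=> i; apply: (@determined_measurable n) => y z e' /= <-.
  exact/esym/det.
exists psi, n; split=> //; first by exists (enum 'I_p) => x; rewrite mem_enum.
pose S := \big[setU/set0]_(i < p) symdiff (B `&` f @^-1` [set i]) (U i).
have mSi i : measurable (symdiff (B `&` f @^-1` [set i]) (U i)).
  by apply: measurable_symdiff => //; exact: measurableI.
have mS : measurable S by exact: bigsetU_measurable.
rewrite -[e]addr0; apply: (measure_le_cover (F := S) (G := ~` B)) => //.
- exact: (label_preimage [set q : 'I_p * 'I_p | q.1 != q.2] (label_pair lf lpsi)).
- exact: measurableC.
- move=> x /= fpsi; have [Bx|nB] := pselect (B x); last by right.
  left; rewrite /S; apply: contrapT => nS; move/eqP: fpsi; apply.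
  have Ui i : U i x <-> f x = i.
    have nSi : ~ symdiff (B `&` f @^-1` [set i]) (U i) x.
      by move=> s; apply: nS; rewrite (bigD1 i)//=; left.
    split=> [Ux|fi]; apply: contrapT => nfi; apply: nSi; first by right; split=> // -[].
    by left.
  rewrite /psi; case: pickP => [i /asboolP/Ui //|/(_ (f x))].
  by move=> /asboolP; case; exact/Ui.
- apply: (@le_trans _ _ (\sum_(i < p) ep%:E)%E).
    suff [] : measurable S /\ (mu S <= \sum_(i < p) ep%:E)%E by [].
    apply: (big_ind2 (fun (V : set X) v => measurable V /\ (mu V <= v)%E)).
    + by rewrite measure0.
    + move=> V v W w [mV Vv] [mW Ww]; split; first exact: measurableU.
      by apply: le_trans (measureU2 mu mV mW) _; exact: leeD.
    + by move=> i _; split=> //; have [_] := projT2 (cid (h i)).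
  rewrite sumEFin lee_fin sumr_const card_ord -mulr_natl /ep mulrC divfK//.
  by rewrite pnatr_eq0 -lt0n.
- by rewrite (measure_setC_fibred hT).
Qed.

End Approximation.


(** * Growth rates and their quotients in the extended reals *)

Section AsymptoticReals.
Variable R : realType.

Lemma ereal_cvg_lt (u : nat -> \bar R) (l c : \bar R) :
  u n @[n --> \oo] --> l -> (l < c)%E -> \forall n \near \oo, (u n < c)%E.
Proof. by move=> cu lc; apply: (cu [set y | (y < c)%E]); exact: open_ereal_lt'. Qed.

Lemma ereal_cvg_gt (u : nat -> \bar R) (l c : \bar R) :
  u n @[n --> \oo] --> l -> (c < l)%E -> \forall n \near \oo, (c < u n)%E.
Proof. by move=> cu lc; apply: (cu [set y | (c < y)%E]); exact: open_ereal_gt'. Qed.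

Lemma near_natr_gt (c : R) : \forall n \near \oo, c < n%:R.
Proof.
exists (Num.truncn c).+1 => // n /= cn.
by apply: lt_le_trans (truncnS_gt _) _; rewrite ler_nat.
Qed.

Lemma near_ler_divn (c c' K : R) : c < c' ->
  \forall n \near \oo, 0 < n%:R :> R /\ c * n%:R + K <= c' * n%:R.
Proof.
move=> cc'; near=> n; have n0 : 0 < n%:R :> R by near: n; exact: near_natr_gt.
split=> //; have : K / (c' - c) < n%:R by near: n; exact: near_natr_gt.
by rewrite ltr_pdivrMr ?subr_gt0// => h; nra.
Unshelve. all: by end_near.
Qed.

Lemma cvg_divn_bounded_diff (u v : nat -> R) (C : R) (l : \bar R) :
  (forall n, `|v n - u n| <= C) ->
  (u n / n%:R)%:E @[n --> \oo] --> l -> (v n / n%:R)%:E @[n --> \oo] --> l.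
Proof.
move=> uv cu; apply: ereal_cvg_sandwich => c lc.
  have [c1 [lc1]] := ereal_lt_between lc; rewrite lte_fin => c1c.
  have h1 := ereal_cvg_lt cu lc1; have h2 := near_ler_divn C c1c.
  near=> n; have [n0 hn] : 0 < n%:R :> R /\ c1 * n%:R + C <= c * n%:R by near: n.
  have : ((u n / n%:R)%:E < c1%:E)%E by near: n.
  rewrite lte_fin lee_fin ltr_pdivrMr// ler_pdivrMr// => h.
  by have := uv n; rewrite ler_norml => /andP[_ h']; lra.
have [c1 [cc1 c1l]] := ereal_lt_between lc; rewrite lte_fin in cc1.
have h1 := ereal_cvg_gt cu c1l; have h2 := near_ler_divn C cc1.
near=> n; have [n0 hn] : 0 < n%:R :> R /\ c * n%:R + C <= c1 * n%:R by near: n.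
have : (c1%:E < (u n / n%:R)%:E)%E by near: n.
rewrite lte_fin lee_fin ltr_pdivlMr// ler_pdivlMr// => h.
by have := uv n; rewrite ler_norml => /andP[h' _]; lra.
Unshelve. all: by end_near.
Qed.

(** Real witnesses treat finite and infinite entropies alike; for [ht = +oo] the quotient is [0] and
    [t] may be taken as large as needed. *)
Lemma slope_above (hs ht : \bar R) (c : R) : (0 <= hs)%E -> (0 < ht)%E ->
  ~ (hs = +oo%E /\ ht = +oo%E) -> (hs / ht < c%:E)%E ->
  exists s t : R, [/\ (hs < s%:E)%E, (t%:E < ht)%E, 0 < t & s <= c * t].
Proof.
case: hs => [s| |] //; case: ht => [t| |] //; rewrite ?lee_fin ?lte_fin => s0 t0 nst.
- rewrite inver gt_eqF// -EFinM lte_fin ltr_pdivrMr// => h.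
  have c0 : 0 < c by rewrite -(pmulr_lgt0 _ t0); exact: le_lt_trans h.
  (* Moving both [s] and [t] by [e] uses up [(1 + c) * e], half of the gap [c * t - s]. *)
  pose e := (c * t - s) / (2 * (1 + c)).
  have e0 : 0 < e by rewrite divr_gt0//; lra.
  have ee : e * (2 * (1 + c)) = c * t - s by rewrite /e divfK// gt_eqF//; lra.
  exists (s + e), (t - e); rewrite !lte_fin; split; nra.
- rewrite mulr0 => c0.
  exists (s + 1), ((s + 1) / c); rewrite lte_fin ltry; split => //; first lra.
    by rewrite divr_gt0//; lra.
  by rewrite mulrC divfK// gt_eqF.
- by rewrite inver gt_eqF// gt0_mulye ?lte_fin ?invr_gt0// ltNge leey.
- by case: nst.
Qed.

Lemma slope_below (hs ht : \bar R) (c : R) : (0 <= hs)%E -> (0 < ht)%E ->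
  ~ (hs = +oo%E /\ ht = +oo%E) -> 0 <= c -> (c%:E < hs / ht)%E ->
  exists s t : R, [/\ (s%:E < hs)%E, (ht < t%:E)%E, 0 < t & c * t < s].
Proof.
case: hs => [s| |] //; case: ht => [t| |] //; rewrite ?lee_fin ?lte_fin => s0 t0 nst c0.
- rewrite inver gt_eqF// -EFinM lte_fin ltr_pdivlMr// => h.
  pose e := (s - c * t) / (2 * (1 + c)).
  have e0 : 0 < e by rewrite divr_gt0//; lra.
  have ee : e * (2 * (1 + c)) = s - c * t by rewrite /e divfK// gt_eqF//; lra.
  exists (s - e), (t + e); rewrite !lte_fin; split; nra.
- by rewrite mulr0 ltNge c0.
- move=> _; exists (c * (t + 1) + 1), (t + 1); rewrite lte_fin ltry; split => //; lra.
- by case: nst.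
Qed.

(** The bound [b (m n) <= a n] gives the upper half, and [a n <= b (m n + r) + C] the lower one.
    Nothing says beforehand that [m n] tends to infinity, so small values of [m n] need separate
    care. *)
Lemma ratio_limit (a b : nat -> R) (m : nat -> nat) (r : nat) (C : R)
    (hs ht : \bar R) :
  (a n / n%:R)%:E @[n --> \oo] --> hs -> (b n / n%:R)%:E @[n --> \oo] --> ht ->
  (0 <= hs)%E -> (0 < ht)%E -> ~ (hs = +oo%E /\ ht = +oo%E) ->
  {homo b : i j / (i <= j)%N >-> i <= j} ->
  (forall n, b (m n) <= a n) -> (forall n, a n <= b (m n + r)%N + C) ->
  ((m n)%:R / n%:R)%:E @[n --> \oo] --> (hs / ht)%E.
Proof.
move=> ca cb hs0 ht0 nst bnd bma abm; apply: ereal_cvg_sandwich => c.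
  move=> /[dup] hc /slope_above -/(_ hs0 ht0 nst) [s [t [hss tht t0 sct]]].
  have c0 : 0 < c.
    rewrite -lte_fin; apply: le_lt_trans hc; apply: mule_ge0 => //.
    by rewrite inve_ge0 ltW.
  have [N _ hN] := ereal_cvg_gt cb tht.
  have h1 := ereal_cvg_lt ca hss; have h2 := near_ler_divn (maxn N 1)%:R c0.
  near=> n.
  have [n0] : 0 < n%:R :> R /\ 0 * n%:R + (maxn N 1)%:R <= c * n%:R by near: n.
  rewrite mul0r add0r => hn.
  rewrite lee_fin ler_pdivrMr//; have [mN|Nm] := leqP (m n) (maxn N 1).
    by apply: le_trans hn; rewrite ler_nat.
  have m0 : 0 < (m n)%:R :> R by rewrite ltr0n; apply: leq_ltn_trans Nm.
  have : (t%:E < (b (m n) / (m n)%:R)%:E)%E.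
    by apply: hN => /=; apply: leq_trans (ltnW Nm); exact: leq_maxl.
  have : ((a n / n%:R)%:E < s%:E)%E by near: n.
  rewrite !lte_fin ltr_pdivrMr// ltr_pdivlMr// => han hbm.
  have := bma n => hba; rewrite -(ler_pM2l t0).
  have : s * n%:R <= c * t * n%:R by rewrite ler_pM2r.
  lra.
have [c0|c0] := ltP c 0.
  by move=> _; apply: nearW => n; rewrite lee_fin (le_trans (ltW c0)).
move=> /slope_below -/(_ hs0 ht0 nst c0) [s [t [shs htt t0 cts]]].
have [N _ hN] := ereal_cvg_lt cb htt.
(* Monotonicity of [b] extends the linear bound from large indices to all of them, at the price of a
   constant. *)
have ba k : b k <= t * (k + maxn N 1)%:R.
  have bl l : (maxn N 1 <= l)%N -> b l <= t * l%:R.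
    rewrite geq_max => /andP[Nl l0]; have := hN l Nl.
    by rewrite /= lte_fin ltr_pdivrMr ?ltr0n// => /ltW.
  by apply: le_trans (bnd _ _ (leq_addr (maxn N 1) k)) _; apply: bl; exact: leq_addl.
have h1 := ereal_cvg_gt ca shs.
have h2 := near_ler_divn (t * (r + maxn N 1)%:R + C) cts.
near=> n.
have [n0 hn] : 0 < n%:R :> R /\
  c * t * n%:R + (t * (r + maxn N 1)%:R + C) <= s * n%:R by near: n.
have : (s%:E < (a n / n%:R)%:E)%E by near: n.
rewrite lte_fin lee_fin ltr_pdivlMr// ler_pdivlMr// => han.
rewrite -(ler_pM2l t0); have := abm n; have := ba (m n + r)%N.
rewrite -addnA natrD mulrDr; lra.
Unshelve. all: by end_near.
Qed.

End AsymptoticReals.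

(** * Entropy of a fibred system and information of its cylinders *)

Section FibredEntropy.
Variables (R : realType) (B : set R) (T : R -> R) (D : countType) (k : R -> D).
Variable mu : probability (measurableTypeR R) R.
Hypothesis hT : number_theoretic B T k mu.
Let X : measurableType _ := measurableTypeR R.
Let tau : X -> X := total_map hT.
Let alpha : X -> D := total_digit hT.
Let mtau : measurable_fun setT tau := measurable_total_map hT.
Let lalpha : label alpha := label_total_digit hT.
Let inv_tau := total_map_invariant hT.
Let ergo := @total_map_ergodic _ _ _ _ _ _ hT.

Lemma entropy_lump_le (s : seq D) (a0 : D) : uniq s -> a0 \in s ->
  exists2 l : \bar R, entropy_mean mu tau (lump alpha s a0) n @[n --> \oo] --> l &
    (l <= entropy B T mu)%E.
Proof.
move=> us a0s; pose f := lump alpha s a0.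
have lf : label f by exact: label_lump.
have fs x : f x \in s by rewrite /f /lump; case: ifPn.
pose A (i : 'I_(size s)) : set X := B `&` f @^-1` [set nth a0 s i].
have mA i : measurable (A i).
  by apply: measurableI; [exact: (fibred_measurable hT)|exact: lf].
have f_retract x : f (retract hT x) = f x.
  by rewrite /f /lump /alpha /total_digit (retract_id hT (retractP hT x)).
have pA : partition setT A B.
  split.
  - apply/seteqP; split=> x; first by move=> [i _ []].
    move=> Bx; have fx := fs x; rewrite -index_mem in fx.
    by exists (Ordinal fx) => //; split=> //=; rewrite nth_index.
  - move=> i j _ _ [x [[_ /= fi] [_ /= fj]]]; apply/val_inj => /=.
    by apply/eqP; rewrite -(nth_uniq a0 (ltn_ord i) (ltn_ord j) us) -fi -fj.
  (* A digit of [s] keeps its label, so a merged cell contains the original cell, which is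
     nonempty. *)
  - move=> i _; have [_ _ /(_ (nth a0 s i) I) [x [Bx kx]]] := fibred_partition (nt_fibred hT).
    exists x; split=> //=; rewrite /f /lump /alpha /total_digit retract_id// kx.
    by rewrite mem_nth.
exists (entropy_wrt B T mu A); last first.
  by apply: ereal_sup_ubound; exists (size s), A.
apply: cvg_trans (entropy_wrt_lim hT mA pA); apply: near_eq_cvg; apply: nearW => n.
rewrite /entropy_mean; congr (_ * _)%E; apply: eq_entropy_upto => x y; rewrite -/f.
have fE z : f z = nth a0 s (index_of hT pA z).
  by have /index_ofP [_ /= <-] := erefl (index_of hT pA z); rewrite f_retract.
split=> [|e]; first by rewrite (fE x) (fE y) => ->.
by apply/val_inj/eqP; rewrite -(nth_uniq a0 (ltn_ord _) (ltn_ord _) us) -!fE e.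
Qed.

Lemma entropy_ge0 : (0 <= entropy B T mu)%E.
Proof.
have [l cl lh] := @entropy_lump_le [:: alpha 0] (alpha 0) isT (mem_head _ _).
apply: le_trans lh; apply: (lim_ge_near cl); apply: nearW => n.
by apply: entropy_mean_ge0 => //; exact: label_lump.
Qed.

Hypothesis fin_entropy : (entropy B T mu < +oo)%E ->
  (partition_entropy mu (digit_set B k) < +oo)%E.

Lemma shannon_mcmillan_breiman : {ae mu, forall x,
  (info mu (name tau alpha n) x / n%:R)%:E @[n --> \oo] --> entropy B T mu}.
Proof.
set h := entropy B T mu.
(* Rational thresholds leave countably many exceptional sets. The negative ones are excluded from
   the lower half, where nonnegativity of the information is enough. *)
pose P (q : rat) (x : X) :=
  (0 <= (ratr q : R) -> ((ratr q : R)%:E < h)%E -> ~ often mu tau alpha (ratr q) x) /\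
  ((h < (ratr q : R)%:E)%E -> eventually_ge mu tau alpha (ratr q) x).
have aeP q : {ae mu, forall x, P q x}.
  have low : 0 <= (ratr q : R) -> ((ratr q : R)%:E < h)%E ->
      {ae mu, forall x, ~ often mu tau alpha (ratr q) x}.
    move=> q0 qh; have [_ [p [A [mA pA ->]]] qA] := ereal_sup_gt qh.
    apply: (lower_bound mtau inv_tau ergo lalpha (label_index_of hT mA pA) _ _
      (entropy_wrt_lim hT mA pA) q0 qA).
      by exists (enum 'I_p) => x; rewrite mem_enum.
    by move=> de de0; exact: (approximable_label hT (label_index_of hT mA pA) de0).
  have upp : (h < (ratr q : R)%:E)%E ->
      {ae mu, forall x, eventually_ge mu tau alpha (ratr q) x}.
    move=> hq; have [c [hc cq]] := ereal_lt_between hq; rewrite lte_fin in cq.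
    apply: (upper_bound_lump mtau inv_tau ergo lalpha (a0 := alpha 0) (c := c)).
    (* A real number above [h] exists here, so [h < +oo] and [fin_entropy] applies. *)
    - rewrite -(partition_entropy_digit hT); apply: fin_entropy.
      by apply: lt_trans hq _; rewrite ltry.
    - rewrite cq andbT -lee_fin; apply: le_trans (ltW hc); exact: entropy_ge0.
    - move=> s us a0s; have [l cl lh] := entropy_lump_le us a0s.
      by exists l => //; exact: le_lt_trans hc.
  have [q0|q0] := pselect (0 <= (ratr q : R) /\ ((ratr q : R)%:E < h)%E).
    have := low q0.1 q0.2; apply: filterS => x nx; split=> // hq.
    by move: q0.2; rewrite ltNge (ltW hq).
  have [hq|hq] := pselect ((h < (ratr q : R)%:E)%E).
    have := upp hq; apply: filterS => x ex; split=> // ? ?; exfalso; exact: q0.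
  by apply: aeW => x; split=> [h1 h2|h3]; exfalso; [exact: q0|exact: hq].
have aeP' : {ae mu, forall x, forall j : nat,
    if unpickle j is Some q then P q x else True}.
  apply: ae_foralln => j; case: (unpickle j) => [q|]; first exact: aeP.
  exact: aeW.
have lname n := label_name mtau n lalpha.
have aepos := ae_foralln (fun n => ae_prob_gt0 mu (lname n)).
move: aeP' aepos; apply: filterS2 => x hPx pos.
have hP q : P q x by have := hPx (pickle q); rewrite pickleK.
apply: ereal_cvg_sandwich => c hc.
  have [c1 [hc1]] := ereal_lt_between hc; rewrite lte_fin => /rat_in_itvoo[q].
  rewrite in_itv /= => /andP[c1q qc]; have [_ ev] := hP q.
  have [|m hm] := ev; first by apply: lt_trans hc1 _; rewrite lte_fin.
  have h2 := near_ler_divn m%:R qc; near=> n.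
  have [n0 hn] : 0 < n%:R :> R /\ ratr q * n%:R + m%:R <= c * n%:R by near: n.
  rewrite lee_fin ler_pdivrMr//; apply: le_trans hn.
  have mn : (m <= n)%N by near: n; exact: nbhs_infty_ge.
  have := hm n mn; rewrite (prob_expR (pos n)) ler_expR; lra.
have [c0|c0] := ltP c 0.
  apply: nearW => n; rewrite lee_fin (le_trans (ltW c0))// divr_ge0//.
  exact: (info_ge0 mu (lname n)).
have [c1 [cc1 c1h]] := ereal_lt_between hc.
move: cc1; rewrite lte_fin => /rat_in_itvoo[q]; rewrite in_itv /= => /andP[cq qc1].
have [no _] := hP q.
have q0 : 0 <= (ratr q : R) by apply: le_trans c0 (ltW cq).
have qh : ((ratr q : R)%:E < h)%E by apply: lt_trans c1h; rewrite lte_fin.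
have [K hK] : exists K, forall n, (K <= n)%N ->
    ~ (expR (- (ratr q * n%:R)) <= prob mu (name tau alpha n) x).
  apply: contrapT => nK; apply: (no q0 qh) => K; apply: contrapT => nn.
  by apply: nK; exists K => n Kn hn; apply: nn; exists n.
exists (maxn K 1) => // n /=; rewrite geq_max => /andP[Kn n0].
have /negP := hK n Kn; rewrite -ltNge (prob_expR (pos n)) ltr_expR => hn.
have n0' : 0 < n%:R :> R by rewrite ltr0n.
rewrite lee_fin ler_pdivlMr//; have : c * n%:R <= ratr q * n%:R.
  by rewrite ler_pM2r// ltW.
lra.
Unshelve. all: by end_near.
Qed.

End FibredEntropy.


(** * Comparison of two fibred maps *)

Lemma largestP (P : set nat) (b : nat) : P 0%N -> (forall l, P l -> (l <= b)%N) ->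
  P (largest P) /\ forall l, P l -> (l <= largest P)%N.
Proof.
move=> P0 Pb; have ex : exists l, `[< P l >] by exists 0%N; apply/asboolP.
have ub l : `[< P l >] -> (l <= b)%N by move=> /asboolP/Pb.
apply: (xgetPex 0%N (P := [set m | P m /\ forall l, P l -> (l <= m)%N])).
case: (ex_maxnP ex ub) => l /asboolP Pl lmax; exists l; split=> // i Pi.
by apply: lmax; apply/asboolP.
Qed.

(** * Intervals, cylinders and Lebesgue measure *)

Section Intervals.
Variable R : realType.

(** A continuous injection is monotone on each segment of the interval, so values between those at
    two points stay between them. *)
Lemma is_interval_preimage (I J : set R) (f : R -> R) :
  is_interval I -> {within I, continuous f} -> set_inj I f -> is_interval J ->
  is_interval (I `&` f @^-1` J).
Proof.
move=> iI cf injf iJ x y [Ix Jx] [Iy Jy] z /andP[xz zy].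
have sub : [set` `[x, y]] `<=` I.
  by move=> t /=; rewrite in_itv /= => txy; exact: (iI x y).
have cxy : {within [set` `[x, y]], continuous f} by exact: continuous_subspaceW cf.
have ixy : {in `[x, y] &, injective f}.
  by move=> s t sxy txy; apply: injf; rewrite inE; apply: sub.
have xy : x <= y by exact: le_trans zy.
have zI : z \in `[x, y] by rewrite in_itv /= xz zy.
have xI : x \in `[x, y] by rewrite in_itv /= lexx.
have yI : y \in `[x, y] by rewrite in_itv /= xy lexx.
split; first exact: sub.
have [fxy|/ltW fyx] := leP (f x) (f y).
  have mf := segment_continuous_inj_le fxy cxy ixy.
  by apply: (iJ _ _ Jx Jy); rewrite !mf// xz zy.
have mf := segment_continuous_inj_ge fyx cxy ixy.
by apply: (iJ _ _ Jy Jx); rewrite !mf// zy xz.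
Qed.

(** The closure adds at most the two endpoints. For an unbounded or empty [I], [sup] or [inf] may be
    a default value, but one more point does not change the measure. *)
Lemma lebesgue_measure_closure_itv (I : set R) : is_interval I ->
  (lebesgue_measure (closure I) = lebesgue_measure I)%E.
Proof.
move=> iI; have mI : measurable (I : set (measurableTypeR R)).
  exact: is_interval_measurable iI.
have mcI : measurable (closure I : set (measurableTypeR R)).
  exact: closed_measurable (@closed_closure _ I).
have sub : closure I `<=` I `|` ([set sup I] `|` [set inf I]).
  move=> x cx; have [Ix|nIx] := pselect (I x); [by left|right].
  have near0 e : 0 < e -> exists2 t, I t & `|x - t| < e.
    by move=> e0; have [t [It /= xt]] := cx _ (nbhsx_ballx x e e0); exists t.
  have [t0 It0 _] := near0 1 ltr01.
  have [t0x|xt0|xt0] := ltgtP t0 x; last by rewrite xt0 in It0.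
    left; have ub : ubound I x.
      move=> t It; rewrite leNgt; apply/negP => xt; apply: nIx.
      by apply: (iI _ _ It0 It); rewrite !ltW.
    have hs : has_sup I by split; [exists t0|exists x].
    apply/le_anti/andP; split; last by apply: ge_sup => //; exists t0.
    rewrite leNgt; apply/negP => sx.
    have [|t It] := near0 (x - sup I); first by rewrite subr_gt0.
    rewrite ltr_norml => /andP[_ h].
    by have := sup_upper_bound hs It; lra.
  right; have lb : lbound I x.
    move=> t It; rewrite leNgt; apply/negP => tx; apply: nIx.
    by apply: (iI _ _ It It0); rewrite !ltW.
  have hi : has_inf I by split; [exists t0|exists x].
  apply/le_anti/andP; split; first by apply: lb_le_inf => //; exists t0.
  rewrite leNgt; apply/negP => xi.
  have [|t It] := near0 (inf I - x); first by rewrite subr_gt0.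
  rewrite ltr_norml => /andP[h _].
  by have := ge_inf hi.2 It; lra.
apply/eqP; rewrite eq_le; apply/andP; split; last first.
  by apply: le_measure; rewrite ?inE//; exact: subset_closure.
have ms : measurable ([set sup I] `|` [set inf I] : set (measurableTypeR R)).
  by apply: measurableU; exact: measurable_set1.
apply: (@le_trans _ _ (lebesgue_measure (I `|` ([set sup I] `|` [set inf I])))).
  by apply: le_measure; rewrite ?inE//; exact: measurableU.
rewrite measureU0// measureU0; first exact: lebesgue_measure_set1.
- exact: measurable_set1.
- exact: measurable_set1.
- exact: lebesgue_measure_set1.
Qed.
End Intervals.

Section FibredCylinders.
Variables (R : realType) (B : set R) (T : R -> R) (D : countType) (k : R -> D).
Variable mu : probability (measurableTypeR R) R.
Hypothesis hT : number_theoretic B T k mu.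

Lemma in_cylinder n (w : n.-tuple D) x : cylinder B T (digit_set B k) w x ->
  cylinder B T (digit_set B k) w = cylinder_at B T k n x.
Proof.
move=> [Bx hx]; congr (cylinder _ _ _ _); apply: eq_from_tnth => i.
by rewrite tnth_mktuple; have [_ /= ->] := hx i.
Qed.

Lemma cylinder_at_self n x : B x -> cylinder_at B T k n x x.
Proof.
move=> Bx; split=> // i; rewrite tnth_mktuple; split=> //.
exact: (iter_fibred_map hT).
Qed.

Lemma cylinder_at_sub n x : cylinder_at B T k n x `<=` B.
Proof. by move=> y []. Qed.

Lemma cylinder_at_le m n x : (m <= n)%N ->
  cylinder_at B T k n x `<=` cylinder_at B T k m x.
Proof.
move=> mn y [By h]; split=> // i; have := h (widen_ord mn i).
by rewrite !tnth_mktuple.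
Qed.

(** The first digit is split off, rather than the last, so that one preimage under [T] within a
    single digit interval remains and [is_interval_preimage] applies. *)
Lemma cylinder_atS n x : cylinder_at B T k n.+1 x =
  digit_set B k (k x) `&` T @^-1` cylinder_at B T k n (T x).
Proof.
apply/seteqP; split=> y.
  move=> [By h]; split.
    by have := h ord0; rewrite tnth_mktuple.
  split; first exact: (fibred_map hT).
  move=> i; have := h (lift ord0 i); rewrite !tnth_mktuple lift0.
  by rewrite !iterSr.
move=> [[By ky] [BTy h]]; split=> // i; rewrite tnth_mktuple.
case: (unliftP ord0 i) => [j ->|->]; last by split.
by have := h j; rewrite tnth_mktuple lift0 !iterSr.
Qed.

Lemma is_interval_cylinder_at n x : B x -> is_interval (cylinder_at B T k n x).
Proof.
have fT := nt_fibred hT.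
elim: n x => [|n IH] x Bx.
  rewrite (_ : cylinder_at B T k 0 x = B); first exact: fibred_interval fT.
  by apply/seteqP; split=> [y []//|y By]; split=> // -[].
rewrite cylinder_atS; apply: is_interval_preimage.
- exact: (@fibred_digit_interval _ _ _ _ _ fT (k x)).
- exact: (@fibred_continuous _ _ _ _ _ fT (k x)).
- exact: (@fibred_injective _ _ _ _ _ fT (k x)).
- by apply: IH; exact: (fibred_map hT).
Qed.

Lemma lebesgue_comparable : exists c1 c2 : R, [/\ 0 < c1, 0 < c2 &
  forall E : set (measurableTypeR R), measurable E -> E `<=` B ->
    [/\ lebesgue_measure E \is a fin_num,
        c1 * fine (lebesgue_measure E) <= fine (mu E) &
        fine (mu E) <= c2 * fine (lebesgue_measure E)]].
Proof.
have [c1 [c2 [c10 c12 h]]] := nt_equivalent hT; exists c1, c2.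
split=> //; first exact: lt_trans c12.
move=> E mE EB; have [h1 h2] := h E mE EB.
have fE : lebesgue_measure E \is a fin_num.
  (* Infinite Lebesgue measure would force [mu E] to be infinite, since [c1 > 0]. *)
  rewrite ge0_fin_numE// ltey; apply/eqP => Ey; move: h1.
  by rewrite Ey gt0_muley ?lte_fin// leye_eq -(fine_probE mu mE).
by split=> //; rewrite -lee_fin EFinM (fineK fE) (fine_probE mu mE).
Qed.

Hypothesis fin_entropy : (entropy B T mu < +oo)%E ->
  (partition_entropy mu (digit_set B k) < +oo)%E.

(** Equivalence of the measures carries null sets over, and changes the logarithms by at most a
    constant, which vanishes after division by [n]. *)
Lemma smb_lebesgue : {ae @lebesgue_measure R, forall x, B x ->
  (forall n, 0 < fine (lebesgue_measure (cylinder_at B T k n x))) /\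
  ((- ln (fine (lebesgue_measure (cylinder_at B T k n x))) / n%:R)%:E
    @[n --> \oo] --> entropy B T mu)}.
Proof.
have [c1 [c2 [c10 c20 hc]]] := lebesgue_comparable.
have [N [mN N0 hN]] := shannon_mcmillan_breiman hT fin_entropy.
have lname n := label_name (measurable_total_map hT) n (label_total_digit hT).
have [N' [mN' N'0 hN']] := ae_foralln (fun n => ae_prob_gt0 mu (lname n)).
have mB := fibred_measurable hT.
have mBN : measurable (B `&` (N `|` N') : set (measurableTypeR R)).
  by apply: measurableI => //; exact: measurableU.
have BNB : B `&` (N `|` N') `<=` B by move=> x [].
exists (B `&` (N `|` N')); split=> //.
  have [fin h1 _] := hc _ mBN BNB.
  have m0 : fine (mu (B `&` (N `|` N'))) = 0.
    rewrite (measure_setI_fibred hT); last exact: measurableU.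
    have e : mu (N `|` N') = mu N by exact: measureU0.
    by rewrite e N0.
  rewrite -(fineK fin); congr EFin; apply/le_anti; rewrite fine_ge0// andbT.
  by rewrite -(pmulr_rle0 _ c10) -m0.
move=> x /= /not_implyP[Bx hx]; split=> //; apply: contrapT => /not_orP[nN nN'].
have pos : forall n, 0 < prob mu (name (total_map hT) (total_digit hT) n) x.
  by apply: contrapT => h; apply: nN'; exact: hN'.
apply: hx; have cyl n := hc _ (measurable_cylinder_at hT n Bx) (@cylinder_at_sub n x).
have lpos n : 0 < fine (lebesgue_measure (cylinder_at B T k n x)).
  have [_ _] := cyl n; rewrite (measure_cylinder_at hT)// => h.
  by rewrite -(pmulr_rgt0 _ c20); exact: lt_le_trans h.
split=> //.
have cvgN : (info mu (name (total_map hT) (total_digit hT) n) x / n%:R)%:E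
    @[n --> \oo] --> entropy B T mu.
  by apply: contrapT => h; apply: nN; exact: hN.
apply: (cvg_divn_bounded_diff (C := `|ln c1| + `|ln c2|)) cvgN => n.
have [_ h1 h2] := cyl n; rewrite (measure_cylinder_at hT)// in h1 h2.
move: h1 h2; rewrite -ler_ln ?posrE ?mulr_gt0// lnM ?posrE// => h1.
rewrite -ler_ln ?posrE ?mulr_gt0// lnM ?posrE// => h2.
rewrite /info ler_norml.
have := ler_norm (ln c1); have := ler_norm (ln c2).
have := lerNnormlW (lexx `|ln c1|); have := lerNnormlW (lexx `|ln c2|).
by move=> *; apply/andP; split; lra.
Qed.

End FibredCylinders.


Section Comparison.
Variables (R : realType) (B : set R).
Variables (S : R -> R) (DS : countType) (kS : R -> DS).
Variables (muS : probability (measurableTypeR R) R).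
Variables (T : R -> R) (DT : countType) (kT : R -> DT).
Variables (muT : probability (measurableTypeR R) R).
Hypothesis hS : number_theoretic B S kS muS.
Hypothesis hT : number_theoretic B T kT muT.

(** Any cylinder of [T] that contains [A_n(x)] contains [x], so it is the cylinder of its rank at
    [x]. Thus the rank in the definition of regularity is [m(x,n)]. *)
Lemma interval_rank_matching x n : B x ->
  interval_rank B T kT (cylinder_at B S kS n x) = matching_rank B S kS T kT x n.
Proof.
move=> Bx; congr largest; apply/seteqP; split=> m /=.
  move=> [w _ sub]; rewrite -(in_cylinder (w := w))//.
  by apply: sub; exact: (cylinder_at_self hS).
move=> sub; exists [tuple kT (iter i T x) | i < m] => //.
exists x => // i; rewrite tnth_mktuple; split=> //; exact: (iter_fibred_map hT).
Qed.

End Comparison.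

Local Open Scope ereal_scope.

Theorem theorem3p1 (R : realType) (B : set R)
    (S : R -> R) (DS : countType) (kS : R -> DS)
    (muS : probability (measurableTypeR R) R)
    (T : R -> R) (DT : countType) (kT : R -> DT)
    (muT : probability (measurableTypeR R) R)
    (r : nat)
    (hS : number_theoretic B S kS muS)
    (hT : number_theoretic B T kT muT)
    (* finiteness assumption of the Shannon-McMillan-Breiman theorem; without
       it the statement is false *)
    (finS : entropy B S muS < +oo ->
            partition_entropy muS (digit_set B kS) < +oo)
    (finT : entropy B T muT < +oo ->
            partition_entropy muT (digit_set B kT) < +oo)
    (* the quotient h(S)/h(T) is defined *)
    (hT0 : entropy B T muT != 0)
    (hST : ~ (entropy B S muS = +oo /\ entropy B T muT = +oo))
    (regT : regular B T kT r) :
  {ae @lebesgue_measure R, forall x : R, B x ->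
     ((matching_rank B S kS T kT x n)%:R / n%:R)%:E @[n --> \oo] -->
       entropy B S muS / entropy B T muT}.
Proof.
have aeF : Filter (almost_everywhere (@lebesgue_measure R)).
  exact: ae_filter_ringOfSetsType.
have [L L1 [adjL regI]] := regT.
have L0 : (0 < L)%R by exact: lt_le_trans L1.
have hTpos : 0 < entropy B T muT by rewrite lt_def hT0 (entropy_ge0 hT).
pose near_inside n (w : n.-tuple DS) x :=
  let I := cylinder B S (digit_set B kS) w in
  I x -> 0 < @lebesgue_measure R I -> exists2 j, (0 < j <= r)%N &
    let l := (interval_rank B T kT I + j)%N in
    cylinder_at B T kT l x `<=` I \/
    exists2 C, Defs.adjacent B T kT l (cylinder_at B T kT l x) C & C `<=` I.
have aeIw n w : {ae @lebesgue_measure R, forall x, @near_inside n w x}.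
  set I := cylinder B S (digit_set B kS) w.
  have [[y Iy]|nI] := pselect (exists y, I y); last first.
    by apply: aeW => x; rewrite /near_inside /= => Ix; case: nI; exists x.
  have [I0|I0] := pselect (0 < @lebesgue_measure R I).
    have IE : I = cylinder_at B S kS n y by exact: in_cylinder.
    have iI : is_interval I.
      by rewrite IE; apply: (is_interval_cylinder_at hS); case: Iy.
    have IB : I `<=` B by move=> x [].
    have := regI I iI IB I0; apply: filterS => x h.
    by rewrite /near_inside /= => Ix _; exact: h.
  by apply: aeW => x; rewrite /near_inside /= => Ix /I0.
have aeI : {ae @lebesgue_measure R, forall x, forall n m : nat,
    if unpickle m is Some w then @near_inside n w x else True}.
  apply: ae_foralln => n; apply: ae_foralln => m.
  by case: (unpickle m) => [w|]; [exact: aeIw|exact: aeW].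
have [c1 [c2 [_ _ hcT]]] := lebesgue_comparable hT.
move: (smb_lebesgue hS finS) (smb_lebesgue hT finT) aeI.
apply: filterS3 => x smbSx smbTx hx Bx.
have [posS cvgS] := smbSx Bx; have [posT cvgT] := smbTx Bx.
pose lS n := fine (@lebesgue_measure R (cylinder_at B S kS n x)).
pose lT n := fine (@lebesgue_measure R (cylinder_at B T kT n x)).
have lSpos n : (0 < lS n)%R by exact: posS.
have lTpos n : (0 < lT n)%R by exact: posT.
have finl (E : set (measurableTypeR R)) : measurable E -> E `<=` B ->
    @lebesgue_measure R E \is a fin_num by move=> mE EB; have [] := hcT E mE EB.
have le_fine (E F : set (measurableTypeR R)) : measurable E -> measurable F ->
    F `<=` B -> E `<=` F ->
    (fine (@lebesgue_measure R E) <= fine (@lebesgue_measure R F))%R.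
  move=> mE mF FB EF; have EB : E `<=` B by exact: subset_trans FB.
  by rewrite fine_le ?finl// le_measure ?inE.
have mcS n := measurable_cylinder_at hS n Bx.
have mcT n := measurable_cylinder_at hT n Bx.
have lT_le i j : (i <= j)%N -> (lT j <= lT i)%R.
  move=> ij; apply: le_fine => //; first exact: cylinder_at_sub.
  exact: cylinder_at_le.
pose P n := [set m | cylinder_at B S kS n x `<=` cylinder_at B T kT m x].
have lTS n m : P n m -> (lS n <= lT m)%R.
  by move=> Pnm; apply: le_fine => //; exact: cylinder_at_sub.
have lnT i j : (i <= j)%N -> (- ln (lT i) <= - ln (lT j))%R.
  by move=> ij; rewrite lerN2 ler_ln ?posrE ?lSpos ?lTpos//; exact: lT_le.
(* [largest] returns its default value on unbounded sets. Positive entropy of [T] excludes this: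
   [B_m(x)] shrinks exponentially in [m], so it cannot contain [A_n(x)], of positive measure, for
   large [m]. *)
have P_bounded n : exists b, forall m, P n m -> (m <= b)%N.
  have [t [t0 tT]] := ereal_lt_between hTpos; rewrite lte_fin in t0.
  have [N _ hN] := ereal_cvg_gt cvgT tT.
  pose K := (Num.truncn (- ln (lS n) / t)%R).+1.
  exists (maxn (maxn N 1) K) => m Pnm; rewrite leqNgt; apply/negP.
  rewrite !gtn_max => /andP[/andP[Nm m0] Km].
  have := hN m (ltnW Nm); rewrite /= lte_fin ltr_pdivlMr ?ltr0n ?(ltn_trans _ m0)//.
  rewrite -/(lT m) => tm.
  have : (- ln (lT m) <= - ln (lS n))%R by rewrite lerN2 ler_ln ?posrE ?lSpos ?lTpos//; exact: lTS.
  have : (- ln (lS n) / t < m%:R)%R.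
    by apply: lt_trans (truncnS_gt _) _; rewrite ltr_nat.
  rewrite ltr_pdivrMr// [ltRHS]mulrC => h1 h2.
  by have := lt_trans (lt_le_trans tm h2) h1; rewrite ltxx.
have P0 n : P n 0%N.
  by move=> y [By _]; split=> // -[].
pose m n := matching_rank B S kS T kT x n.
have Pm n : P n (m n).
  by have [b hb] := P_bounded n; have [] := largestP (P0 n) hb.
apply: (ratio_limit (r := r) (C := ln L) cvgS cvgT (entropy_ge0 hS) hTpos hST).
- by move=> i j; exact: lnT.
- by move=> n; rewrite lerN2 ler_ln ?posrE ?lSpos ?lTpos//; exact: lTS.
move=> n.
have /= := hx n (pickle [tuple kS (iter i S x) | i < n]); rewrite pickleK.
have posI : 0 < @lebesgue_measure R (cylinder_at B S kS n x).
  rewrite -(fineK (finl _ (mcS n) (@cylinder_at_sub _ _ _ _ _ n x))) lte_fin.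
  exact: posS.
move=> /(_ (cylinder_at_self hS n Bx) posI) [j /andP[j0 jr]].
rewrite -/(cylinder_at B S kS n x) (interval_rank_matching hS hT n Bx) -/(m n).
set l := (m n + j)%N => hl.
suff : (lT l <= L * lS n)%R.
  move=> h; have h' : (lT (m n + r)%N <= L * lS n)%R.
    by apply: le_trans h; apply: lT_le; rewrite leq_add2l.
  move: h'; rewrite -ler_ln ?posrE ?mulr_gt0// lnM ?posrE// => h'.
  by rewrite lerNl opprD opprK lerBlDl.
case: hl => [sub|[C adj CI]].
  apply: (@le_trans _ _ (lS n)); last by rewrite ler_peMl// ltW.
  by apply: le_fine => //; exact: cylinder_at_sub.
have [_ ratioL] := andP (adjL _ _ _ adj).
have [ratioL' _] := andP (adjL _ _ _ adj).
set I := cylinder_at B S kS n x in CI.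
have iI : is_interval I by exact: (is_interval_cylinder_at hS).
have mcl (E : set R) : measurable (closure E : set (measurableTypeR R)).
  exact: closed_measurable (@closed_closure _ E).
have cI : (fine (@lebesgue_measure R (closure C)) <= lS n)%R.
  rewrite /lS -(lebesgue_measure_closure_itv iI).
  (* The closure may leave [B], so finiteness is inherited from [I] through the equality of
     measures. *)
  have fI : @lebesgue_measure R (closure I) \is a fin_num.
    rewrite (lebesgue_measure_closure_itv iI).
    exact: (finl _ (mcS n) (@cylinder_at_sub _ _ _ _ _ n x)).
  have CI' : @lebesgue_measure R (closure C) <= @lebesgue_measure R (closure I).
    have sub := closure_subset CI.
    apply: (le_measure
      (lebesgue_measure : {measure set (measurableTypeR R) -> \bar R}));
      by rewrite ?inE//; exact: mcl.
  by apply: fine_le => //; rewrite ge0_fin_numE// (le_lt_trans CI')// ltey_eq fI.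
have iT : is_interval (cylinder_at B T kT l x) by exact: (is_interval_cylinder_at hT).
rewrite (lebesgue_measure_closure_itv iT) -/(lT l) in ratioL ratioL'.
(* For a null closure the quotient would be the default [0], against its lower bound [L^-1]. *)
have Cpos : (0 < fine (@lebesgue_measure R (closure C)))%R.
  rewrite lt_def fine_ge0// andbT; apply/eqP => C0; move: ratioL'.
  by rewrite C0 invr0 mulr0 invr_le0 leNgt L0.
apply: (@le_trans _ _ (L * fine (@lebesgue_measure R (closure C)))%R).
  by rewrite -ler_pdivrMr.
by rewrite ler_pM2l.
Qed.
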